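(* Let $H$ be a real Hilbert space and let $A$ be a self-adjoint linear operator on $H$ with dense domain $D(A)$. Assume that there exist a countable orthonormal basis $\{e_k\}_{k\in\mathbb{N}}$ of $H$ and an increasing sequence $\{\lambda_k\}_{k\in\mathbb{N}}$ of positive real numbers such that $Ae_k=\lambda_k^2 e_k$ for every $k\in\mathbb{N}$. Let $u_0\in D(A^{1/2})$, $u_1\in H$, and let $u(t)$ be the unique global weak solution to $$u''(t)+|u'(t)|^2u'(t)+Au(t)=0,\qquad u(0)=u_0,\quad u'(0)=u_1 .$$ Let $u_{0k}$, $u_{1k}$ denote the components of $u_0$, $u_1$ with respect to the basis $\{e_k\}$, and let $J:=\{k\in\mathbb{N}: u_{1k}^2+u_{0k}^2\neq 0\}$. Assume in addition that $J$ is infinite and that $$\inf_{k\in\mathbb{N}}(\lambda_{k+1}-\lambda_k)>0.$$ Then $$\lim_{t\to+\infty}t\left(|u'(t)|^2+|A^{1/2}u(t)|^2\right)=2.$$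
   Context: $|x|$ denotes the norm of $x\in H$ and $\langle x,y\rangle$ the scalar product. $A$ is self-adjoint, i.e. it is the diagonal operator with $D(A)=\{x\in H:\sum_k\lambda_k^4\langle x,e_k\rangle^2<\infty\}$; correspondingly $D(A^{1/2})=\{x\in H:\sum_k\lambda_k^2\langle x,e_k\rangle^2<\infty\}$ and $|A^{1/2}x|^2=\sum_k\lambda_k^2\langle x,e_k\rangle^2$. It is standard that for every $(u_0,u_1)\in D(A^{1/2})\times H$ the Cauchy problem has a unique weak global solution $u\in C^1([0,+\infty),H)\cap C^0([0,+\infty),D(A^{1/2}))$, and that the energy $E(t)=|u'(t)|^2+|A^{1/2}u(t)|^2$ is of class $C^1$ with $E'(t)=-2|u'(t)|^4$ for all $t\ge 0$. In components, the equation reads $u_k''(t)+|u'(t)|^2u_k'(t)+\lambda_k^2u_k(t)=0$ for every $k$, where $|u'(t)|^2=\sum_i|u_i'(t)|^2$. *)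

(* Defs.v *)
From mathcomp Require Import all_boot all_order all_algebra.
From mathcomp Require Import sesquilinear.
From mathcomp Require Import all_classical all_reals all_analysis.

Set Implicit Arguments.
Unset Strict Implicit.
Unset Printing Implicit Defensive.

Import Order.TTheory GRing.Theory Num.Theory.
Import numFieldNormedType.Exports.

Local Open Scope classical_set_scope.
Local Open Scope ring_scope.

(** Differentiation of functions on the closed half-line [0, +oo[ : increments
    are restricted to those staying in the half-line, so the derivative is the
    right derivative at 0 and the ordinary one at t > 0. The values of [f] at
    negative arguments are irrelevant. *)
Section HalfLine.
Context {R : realType} {V : normedModType R}.

Definition quot_ge0 (f : R -> V) (t : R) : set_system V :=
  h^-1 *: (f (t + h) - f t) @[h --> within [set h | 0 <= t + h] (0 : R)^'].

Definition derivable_ge0 (f : R -> V) : Prop :=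
  forall t, 0 <= t -> cvg (quot_ge0 f t).

Definition derive_ge0 (f : R -> V) (t : R) : V := lim (quot_ge0 f t).

Definition continuous_ge0 (f : R -> V) : Prop :=
  {within [set t | 0 <= t], continuous f}.

Definition C1_ge0 (f : R -> V) : Prop :=
  derivable_ge0 f /\ continuous_ge0 (derive_ge0 f).

End HalfLine.

Section Hilbert.
Context {R : realType} {H : completeNormedModType R}.
Variable dot : {dot H for @idfun R}.

(** Together with the completeness of [H] this makes [H] a real Hilbert
    space. *)
Definition norm_from_dot : Prop := forall x : H, `|x| ^+ 2 = dot x x.

Definition orthonormal_basis (e : nat -> H) : Prop :=
  (forall i j, dot (e i) (e j) = (i == j)%:R) /\
  (forall x, series (fun k => dot x (e k) *: e k) @ \oo --> x).

(** An unbounded operator is a pair of a domain [D] and a map [A] of which only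
    the restriction to [D] is meaningful. *)
Definition linear_operator (D : set H) (A : H -> H) : Prop :=
  D 0 /\
  (forall (a : R) x y, D x -> D y ->
     D (a *: x + y) /\ A (a *: x + y) = a *: A x + A y).

Definition graph_of (D : set H) (A : H -> H) : set (H * H) :=
  [set p | D p.1 /\ A p.1 = p.2].

Definition adjoint_graph (D : set H) (A : H -> H) : set (H * H) :=
  [set p | forall x, D x -> dot (A x) p.1 = dot x p.2].

Definition self_adjoint (D : set H) (A : H -> H) : Prop :=
  [/\ linear_operator D A, dense D & adjoint_graph D A = graph_of D A].

(** Domain and value of the square root of the operator that is diagonal in the
    basis [e] with eigenvalues [lam k ^+ 2]. *)
Definition dom_sqrt (e : nat -> H) (lam : nat -> R) : set H :=
  [set x | cvgn (series (fun k => lam k ^+ 2 * dot x (e k) ^+ 2))].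

Definition sqrt_op (e : nat -> H) (lam : nat -> R) (x : H) : H :=
  limn (series (fun k => (lam k * dot x (e k)) *: e k)).

(** Weak global solutions of u'' + |u'|^2 u' + A u = 0 in the class
    C^1([0,+oo[, H) /\ C^0([0,+oo[, D(A^(1/2))), the second space carrying the
    graph norm. The equation is tested against the elements of the domain of
    the self-adjoint operator [A], the term <A u, v> being read as <u, A v>;
    [v = e k] gives the equation for the k-th component. *)
Definition weak_equation (D : set H) (A : H -> H) (u : R -> H) : Prop :=
  forall v, D v ->
    let w : R -> R^o := fun t => dot (derive_ge0 u t) v in
    derivable_ge0 w /\
    forall t, 0 <= t ->
      derive_ge0 w t + `|derive_ge0 u t| ^+ 2 * w t + dot (u t) (A v) = 0.

Definition weak_solution (D : set H) (A : H -> H) (e : nat -> H)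
    (lam : nat -> R) (u0 u1 : H) (u : R -> H) : Prop :=
  [/\ C1_ge0 u,
      (forall t, 0 <= t -> dom_sqrt e lam (u t)),
      continuous_ge0 u /\ continuous_ge0 (fun t => sqrt_op e lam (u t)),
      weak_equation D A u
    & u 0 = u0 /\ derive_ge0 u 0 = u1].

End Hilbert.

(* Main.v *)
Require Import Defs.
From mathcomp Require Import all_boot all_order all_algebra.
From mathcomp Require Import sesquilinear.
From mathcomp Require Import all_classical all_reals all_analysis.
From mathcomp Require Import ring lra.

(** Write a_k = u_k'^2 + lam_k^2 u_k^2 for the energy of the k-th mode, so that
    (u_k', lam_k u_k) turns with angular velocity close to lam_k on a circle of
    radius sqrt a_k, and E = sum_k a_k. The damping coefficient is
    v = |u'|^2 = sum_i u_i'^2, and a_k' = - 2 v u_k'^2. Averaging over the fast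
    angles, u_i'^2 u_k'^2 has mean a_i a_k / 4 for i <> k and 3 a_k^2 / 8 for
    i = k, whence, up to oscillating terms,
      a_k' = - a_k E / 2 - a_k^2 / 4,   E' = - E^2 / 2 - (sum_k a_k^2) / 4.
    If no single mode carries a fixed fraction of the energy, the last sum is
    negligible with respect to E^2, so (1/E)' tends to 1/2 and t E(t) to 2.

    Averaging is made rigorous by exact primitives. In terms of the double
    angle, b_k = lam_k^2 u_k^2 - u_k'^2 and d_k = 2 lam_k u_k u_k' satisfy
    b_k' = 2 lam_k d_k + O(v a_k) and d_k' = - 2 lam_k b_k + O(v a_k). Hence
    b_k, b_k^2 - a_k^2 / 2 and b_i b_k with i <> k are derivatives of small
    quantities up to errors that carry an additional factor v <= E. The
    primitive of b_i b_k has the denominator lam_k^2 - lam_i^2, and the spectral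
    gap bounds it by a multiple of a_i a_k ([small_divisor]), so that the sum
    over all pairs converges and is O(E^2) ([norm_cross_total_le]). The
    primitives are differentiated term by term, which is legitimate because every
    a_k is nonincreasing and the initial energies are summable
    ([is_derive_tsum]).

    That no mode dominates ([sup_mode_negligible]) comes from the logarithmic
    form (ln a_k)' = - E / 2 - a_k / 4 + ... ([log_mode_derive]). Put
    p = exp (- (int E) / 2) and let P be a primitive of p. Up to a bounded
    oscillating factor, p / a_k has a derivative comparable to p; hence its growth
    is comparable to that of P, with constants that depend neither on k nor on the
    time. Only the initial value depends on k. Since P is unbounded, all excited
    modes eventually become comparable to one another, and there are infinitely
    many of them. Finally [inv_energy_asymp] integrates (1/E)'. *)

Set Implicit Arguments.
Unset Strict Implicit.
Unset Printing Implicit Defensive.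

Import Order.TTheory GRing.Theory Num.Theory.
Import numFieldNormedType.Exports.

Local Open Scope classical_set_scope.
Local Open Scope ring_scope.

(** * Monotonicity, primitives and series *)
Section Calculus.
Context {R : realType}.
Implicit Types (f g : R -> R) (s t a : R).

Lemma is_derive_ge0_le f s t : s <= t ->
  (forall x, s <= x <= t -> exists2 D, is_derive x 1 f D & 0 <= D) ->
  f s <= f t.
Proof.
move=> st df.
have [||c cst e] := @MVT_segment R f (fun x => 'D_1 f x) s t st.
- move=> x /[!in_itv]/= /andP[sx xt].
  by have [|D [dfx _] _] := df x; [rewrite !ltW|exact: derivableP].
- apply: continuous_in_subspaceT => x /[!inE]/=/[!in_itv]/= xst.
  apply: differentiable_continuous; apply/derivable1_diffP.
  by have [D [dfx _] _] := df x xst.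
- rewrite in_itv/= in cst; have [D [_ fD] D0] := df c cst.
  by rewrite -subr_ge0 e fD mulr_ge0// subr_ge0.
Qed.

Lemma derive_dist_le f g (M : R) s t :
  (forall x, Num.min s t <= x <= Num.max s t -> is_derive x 1 f (g x)) ->
  (forall x, Num.min s t <= x <= Num.max s t -> `|g x| <= M) ->
  `|f t - f s| <= M * `|t - s|.
Proof.
wlog st : s t / s <= t.
  move=> H df gM; have [st|/ltW ts] := leP s t; first exact: H.
  by rewrite distrC (distrC t); apply: H => // x;
    rewrite minC maxC; [exact: df|exact: gM].
rewrite min_l// max_r// => df gM.
have [||c cst ->] := @MVT_segment R f g s t st.
- by move=> x /[!in_itv]/= /andP[sx xt]; apply: df; rewrite !ltW.
- apply: continuous_in_subspaceT => x /[!inE]/=/[!in_itv]/= xst.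
  by apply: differentiable_continuous; apply/derivable1_diffP; have [] := df x xst.
- by rewrite normrM ler_wpM2r// gM.
Qed.

Lemma antiderivative f a : (forall t, a < t -> {for t, continuous f}) ->
  forall b, a < b ->
  exists F : R -> R, forall t, b < t -> is_derive t 1 F (f t).
Proof.
move=> cf b ab; exists (fun x => (\int[lebesgue_measure]_(t in `[b, x]) f t)%R) => t bt.
have [||||dF Fe] := @continuous_FTC1_closed R f b t (t + 1).
- by rewrite ltrDl.
- apply: continuous_compact_integrable; first exact: segment_compact.
  apply: continuous_in_subspaceT => x /[!inE]/=/[!in_itv]/= /andP[bx _].
  exact/cf/(lt_le_trans ab).
- exact: bt.
- exact/cf/(lt_trans ab).
- apply: DeriveDef; first exact: dF.
  by rewrite -derive1E; exact: Fe.
Qed.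

End Calculus.

Section Series.
Context {R : realType}.
Implicit Types (f g al : nat -> R).

Definition tsum f : R := limn (series f).

Lemma dominated_cvg_series f al c : cvgn (series al) ->
  (forall k, `|f k| <= c * al k) -> cvgn (series f).
Proof.
move=> cal fal; apply: normed_cvg.
apply: (@series_le_cvg _ (fun k => `|f k|) (c *: al)).
- by move=> n; exact: normr_ge0.
- by move=> n; rewrite (le_trans _ (fal n)).
- exact: fal.
- exact: is_cvg_seriesZ.
Qed.

Lemma tsumD f g : cvgn (series f) -> cvgn (series g) ->
  tsum (fun k => f k + g k) = tsum f + tsum g.
Proof. exact: lim_seriesD. Qed.

Lemma tsumB f g : cvgn (series f) -> cvgn (series g) ->
  tsum (fun k => f k - g k) = tsum f - tsum g.
Proof. exact: lim_seriesB. Qed.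

Lemma tsumZ c f : cvgn (series f) -> tsum (fun k => c * f k) = c * tsum f.
Proof. exact: lim_seriesZ. Qed.

Lemma cvg_seriesZ c f : cvgn (series f) -> cvgn (series (fun k => c * f k)).
Proof. exact: is_cvg_seriesZ. Qed.

Lemma ler_tsum f g : cvgn (series f) -> cvgn (series g) ->
  (forall k, f k <= g k) -> tsum f <= tsum g.
Proof. exact: lim_series_le. Qed.

Lemma ler_norm_tsum f g : cvgn (series g) ->
  (forall k, `|f k| <= g k) -> `|tsum f| <= tsum g.
Proof.
move=> cg fg.
have cf : cvgn (series f).
  by apply: (@dominated_cvg_series _ g 1) => // k; rewrite mul1r.
rewrite ler_norml; apply/andP; split; last first.
  by apply: ler_tsum => // k; exact: le_trans (ler_norm _) (fg k).
rewrite -mulN1r -tsumZ//; apply: ler_tsum => //; first exact: cvg_seriesZ.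
by move=> k; have := fg k; rewrite mulN1r ler_norml => /andP[].
Qed.

Lemma ler_sum_tsum f n : cvgn (series f) -> (forall k, 0 <= f k) ->
  \sum_(0 <= k < n) f k <= tsum f.
Proof.
move=> cf f0; have := nondecreasing_cvgn_le _ cf n; apply.
exact: nondecreasing_series.
Qed.

Lemma tsum_ge0 f : (forall k, 0 <= f k) -> cvgn (series f) -> 0 <= tsum f.
Proof. by move=> f0 cf; have := @ler_sum_tsum f 0 cf f0; rewrite big_nil. Qed.

Lemma tsum_ge f k : cvgn (series f) -> (forall k, 0 <= f k) -> f k <= tsum f.
Proof.
move=> cf f0; apply: le_trans (@ler_sum_tsum f k.+1 cf f0).
by rewrite big_nat_recr//= lerDr sumr_ge0.
Qed.

Lemma tsum_single f k : (forall i, i != k -> f i = 0) -> tsum f = f k.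
Proof.
move=> f0; apply/cvg_lim; first exact: Rhausdorff.
apply: cvg_near_cst; exists k.+1 => // n /= kn.
rewrite /series/= (bigD1_seq k)/= ?mem_index_iota ?iota_uniq//.
by rewrite big1 ?addr0.
Qed.

End Series.

Section TermwiseDerivative.
Context {R : realType}.
Implicit Types (al : nat -> R).

(** Dominated convergence for series: the terms beyond a fixed rank contribute at
    most the corresponding tail of [al]. *)
Lemma cvg_tsum_dominated {T} {F : set_system T} {FF : Filter F}
  (r : nat -> T -> R) al :
  cvgn (series al) ->
  (\forall h \near F, forall k, `|r k h| <= al k) ->
  (forall k, r k h @[h --> F] --> 0) ->
  (fun h => tsum (r ^~ h)) @ F --> (0 : R).
Proof.
move=> cal bd r0; apply/cvgr0Pnorm_le => e e0.
have [N _ HN] : \forall N \near \oo, `|tsum al - series al N| <= e / 2.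
  by have /cvgrPdist_le := cal; apply; rewrite divr_gt0.
have sN : (fun h => \sum_(0 <= k < N) `|r k h|) @ F --> (0 : R).
  elim: N {HN} => [|N IH].
    by under eq_fun do rewrite big_nil; exact: cvg_cst.
  under eq_fun do rewrite big_nat_recr//=.
  have := cvgD IH (cvg_norm (r0 N)); rewrite normr0 addr0; exact.
have /cvgr0Pnorm_le/(_ (e / 2)) := sN; rewrite divr_gt0// => /(_ isT) sN'.
near=> h.
have rk k : `|r k h| <= al k by move: k; near: h.
have sh : `|\sum_(0 <= k < N) `|r k h| | <= e / 2 by near: h.
have cr : cvgn (series (r ^~ h)).
  by apply: (@dominated_cvg_series _ _ al 1) => // k; rewrite mul1r.
have cn : cvgn (series (fun k => `|r k h|)).
  apply: (@dominated_cvg_series _ _ al 1) => // k.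
  by rewrite mul1r normr_id.
have h1 : `|tsum (r ^~ h)| <= tsum (fun k => `|r k h|) by exact: ler_norm_tsum.
apply: (le_trans h1).
(* Passing to the limit in the partial sums compares both tails beyond N. *)
have h2 : tsum (fun k => `|r k h|) + series al N
    <= \sum_(0 <= k < N) `|r k h| + tsum al.
  apply: (@ler_cvg_to _ \oo _ _
    (fun n => series (fun k => `|r k h|) n + series al N)
    (fun n => \sum_(0 <= k < N) `|r k h| + series al n)).
  - by apply: cvgD => //; exact: cvg_cst.
  - by apply: cvgD => //; exact: cvg_cst.
  exists N => // n /= Nn; rewrite -[\sum_(0 <= k < N) _]/(series _ N).
  have := sub_series_geq (fun k => `|r k h|) Nn.
  have := sub_series_geq al Nn.
  have : \sum_(N <= k < n) `|r k h| <= \sum_(N <= k < n) al k by exact: ler_sum.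
  by lra.
have : tsum al - series al N <= e / 2.
  exact: le_trans (ler_norm _) (HN N (leqnn N)).
have := ler_norm (\sum_(0 <= k < N) `|r k h|).
lra.
Unshelve. all: by end_near. Qed.

(** By the mean value theorem the difference quotients are dominated by [al]
    too, and the dominated convergence of series applies to them. *)
Lemma is_derive_tsum (f g : nat -> R -> R) al (a : R) :
  cvgn (series al) ->
  (forall k t, a < t -> is_derive t 1 (f k) (g k t)) ->
  (forall t, a < t -> cvgn (series (f ^~ t))) ->
  (forall k t, a < t -> `|g k t| <= al k) ->
  forall t, a < t ->
    is_derive t 1 (fun t => tsum (f ^~ t)) (tsum (g ^~ t)).
Proof.
move=> cal df cf gal t at_.
pose q k (h : R) := h^-1 * (f k (h + t) - f k t) - g k t.
have cg : cvgn (series (g ^~ t)).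
  by apply: (@dominated_cvg_series _ _ al 1) => // k; rewrite mul1r gal.
have nt : \forall h \near (0 : R)^', a < h + t.
  near=> h.
  have : `|h| < t - a by near: h; apply: dnbhs0_lt; rewrite subr_gt0.
  by rewrite ltr_norml => /andP[+ _]; lra.
have q0 : (fun h => tsum (q ^~ h)) @ (0 : R)^' --> (0 : R).
  apply: (@cvg_tsum_dominated _ _ _ _ (fun k => 2 * al k)).
  - exact: cvg_seriesZ.
  - near=> h => k.
    have h0 : h != 0 by near: h; exact: nbhs_dnbhs_neq.
    have ah : a < h + t by near: h.
    have dq : `|f k (h + t) - f k t| <= al k * `|h|.
      rewrite -[in leRHS](addrK t h); apply: derive_dist_le.
        move=> x /andP[+ _]; rewrite ge_min => xm; apply: df.
        by case/orP : xm; apply: lt_le_trans.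
      move=> x /andP[+ _]; rewrite ge_min => xm; apply: gal.
      by case/orP : xm; apply: lt_le_trans.
    rewrite /q (le_trans (ler_normB _ _))// mulr_natl mulr2n lerD ?gal//.
    by rewrite normrM normfV ler_pdivrMl ?normr_gt0// mulrC.
  - move=> k; have [dk ek] := df k t at_.
    move: ek; have := dk; rewrite /derivable => /cvg_ex[l hl].
    rewrite /derive (cvg_lim _ hl)// => el.
    have hh := cvgB hl (cvg_cst (g k t)).
    rewrite el subrr in hh; apply: (cvg_trans _ (hh _ _)).
    by apply: near_eq_cvg; near=> h => /=; rewrite fctE /= -[h%:A]/(h * 1) mulr1.
have hc : (fun h => h^-1 *: (((fun t => tsum (f ^~ t)) \o shift t) (h *: 1)
    - tsum (f ^~ t))) @ (0 : R)^' --> tsum (g ^~ t).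
  have hh := cvgD q0 (cvg_cst (tsum (g ^~ t))).
  rewrite add0r in hh; apply: (cvg_trans _ (hh _ _)).
  apply: near_eq_cvg; near=> h => /=.
  have ah : a < h + t by near: h.
  rewrite !fctE -[h%:A]/(h * 1) mulr1 /q.
  rewrite tsumB// ?subrK.
    by rewrite tsumZ ?tsumB//; [exact: cf|exact: cf|apply: is_cvg_seriesB; exact: cf].
  by apply: cvg_seriesZ; apply: is_cvg_seriesB; exact: cf.
apply: DeriveDef; last by rewrite /derive (cvg_lim _ hc).
by rewrite /derivable; apply/cvg_ex; exists (tsum (g ^~ t)); exact: hc.
Unshelve. all: by end_near. Qed.

End TermwiseDerivative.

(** * Averaging the system of modes *)
Section PointwiseDerivatives.
Context {R : realType}.
Implicit Types (f g : R -> R) (t : R).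

(** The rules of differentiation for lambda terms: unlike their counterparts for
    [f + g] or [f * g], they can be found by unification from the syntax of the
    function, which is what the tactic [pderiv] does. *)
Lemma pderiv_cst t (c : R) : is_derive t 1 (fun _ : R => c) 0.
Proof. exact: is_derive_cst. Qed.

Lemma pderiv_add f g t df dg : is_derive t 1 f df -> is_derive t 1 g dg ->
  is_derive t 1 (fun s => f s + g s) (df + dg).
Proof. exact: is_deriveD. Qed.

Lemma pderiv_opp f t df : is_derive t 1 f df ->
  is_derive t 1 (fun s => - f s) (- df).
Proof. exact: is_deriveN. Qed.

Lemma pderiv_mul f g t df dg : is_derive t 1 f df -> is_derive t 1 g dg ->
  is_derive t 1 (fun s => f s * g s) (df * g t + f t * dg).
Proof.
move=> hf hg; apply: is_derive_eq (is_deriveM hf hg) _.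
by rewrite addrC /GRing.scale/= mulrC.
Qed.

Lemma pderiv_inv f t df : f t != 0 -> is_derive t 1 f df ->
  is_derive t 1 (fun s => (f s)^-1) (- df / f t ^+ 2).
Proof.
move=> f0 hf; apply: is_derive_eq (is_deriveV f0 hf) _.
by rewrite /GRing.scale/= !mulNr mulrC.
Qed.

Lemma pderiv_exp f t df : is_derive t 1 f df ->
  is_derive t 1 (fun s => expR (f s)) (df * expR (f t)).
Proof.
move=> hf; rewrite mulrC.
exact: (@is_derive1_comp _ expR f t _ _ (is_derive_expR (f t)) hf).
Qed.

Lemma pderiv_ln f t df : 0 < f t -> is_derive t 1 f df ->
  is_derive t 1 (fun s => ln (f s)) (df / f t).
Proof.
move=> f0 hf; rewrite mulrC.
exact: (@is_derive1_comp _ (@ln R) f t _ _ (is_derive1_ln f0) hf).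
Qed.

End PointwiseDerivatives.

Ltac pderiv := repeat first
  [ eassumption | eapply pderiv_cst | eapply pderiv_add | eapply pderiv_opp
  | eapply pderiv_mul | eapply pderiv_inv | eapply pderiv_exp
  | eapply pderiv_ln ].

Lemma ler_normM {R : realType} (x y X Y : R) :
  `|x| <= X -> `|y| <= Y -> `|x * y| <= X * Y.
Proof. by move=> hx hy; rewrite normrM ler_pM. Qed.

Section ModeSystem.
Context {R : realType}.
Implicit Types (t s c : R) (k i : nat) (f : nat -> R).
(** The system satisfied by the energies [a], with [b = a cos (2 theta)] and
    [d = a sin (2 theta)] for the phase [theta] of each mode; [v] is |u'|^2. *)
Variables (lam al : nat -> R) (mu del : R) (v : R -> R) (a b d : nat -> R -> R).
Hypothesis mu_gt0 : 0 < mu.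
Hypothesis lam_ge : forall k, mu <= lam k.
Hypothesis del_gt0 : 0 < del.
Hypothesis gap : forall i k, i != k -> del <= `|lam k - lam i|.
Hypothesis al_cvg : cvgn (series al).
Hypothesis a_derive : forall k t, 0 < t ->
  is_derive t 1 (a k) (- (v t * (a k t - b k t))).
Hypothesis b_derive : forall k t, 0 < t ->
  is_derive t 1 (b k) (2 * lam k * d k t + v t * (a k t - b k t)).
Hypothesis d_derive : forall k t, 0 < t ->
  is_derive t 1 (d k) (- (2 * lam k * b k t) - v t * d k t).
Hypothesis bd_a : forall k t, 0 < t -> b k t ^+ 2 + d k t ^+ 2 = a k t ^+ 2.
Hypothesis a_ge0 : forall k t, 0 < t -> 0 <= a k t.
Hypothesis a_le : forall k t, 0 < t -> a k t <= al k.
Hypothesis v_def : forall t, 0 < t -> 2 * v t = tsum (fun k => a k t - b k t).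

Let lam_gt0 k : 0 < lam k. Proof. exact: lt_le_trans (lam_ge k). Qed.

Lemma norm_b_le k t : 0 < t -> `|b k t| <= a k t.
Proof.
move=> t0; rewrite -(@ler_pXn2r _ 2)// ?nnegrE ?a_ge0//.
by rewrite real_normK ?num_real// -bd_a// lerDl sqr_ge0.
Qed.

Lemma norm_d_le k t : 0 < t -> `|d k t| <= a k t.
Proof.
move=> t0; rewrite -(@ler_pXn2r _ 2)// ?nnegrE ?a_ge0//.
by rewrite real_normK ?num_real// -bd_a// lerDr sqr_ge0.
Qed.

Definition energy t := tsum (a ^~ t).
Definition sum_b t := tsum (b ^~ t).
Definition sum_b_sq t := tsum (fun k => b k t ^+ 2).
(** This is u_k u_k', and [pairing] is the scalar product of u and u'. *)
Definition mode_pairing k t := d k t / (2 * lam k).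
Definition pairing t := tsum (mode_pairing ^~ t).
Local Notation M := (tsum al).

Lemma cvg_a t : 0 < t -> cvgn (series (a ^~ t)).
Proof.
move=> t0; apply: (@dominated_cvg_series _ _ al 1) => // k.
by rewrite mul1r ger0_norm ?a_ge0 ?a_le.
Qed.

(** Every series below is compared with the energy, mode by mode. *)
Lemma cvg_dom t f c : 0 < t -> (forall k, `|f k| <= c * a k t) ->
  cvgn (series f).
Proof. by move=> t0; apply: dominated_cvg_series; exact: cvg_a. Qed.

Lemma tsum_dom t f c : 0 < t -> (forall k, `|f k| <= c * a k t) ->
  `|tsum f| <= c * energy t.
Proof.
move=> t0 fa; rewrite /energy -tsumZ; last exact: cvg_a.
by apply: ler_norm_tsum => //; apply: cvg_seriesZ; exact: cvg_a.
Qed.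

Lemma is_derive_tsum_dom (f g : nat -> R -> R) c c' : 0 <= c' ->
  (forall k t, 0 < t -> is_derive t 1 (f k) (g k t)) ->
  (forall k t, 0 < t -> `|f k t| <= c * a k t) ->
  (forall k t, 0 < t -> `|g k t| <= c' * a k t) ->
  forall t, 0 < t -> is_derive t 1 (fun t => tsum (f ^~ t)) (tsum (g ^~ t)).
Proof.
move=> c0 df fa ga t t0.
apply: (@is_derive_tsum _ f g (fun k => c' * al k) 0) => //.
- exact: cvg_seriesZ.
- by move=> s s0; apply: (@cvg_dom s _ c) => // k; exact: fa.
- by move=> k s s0; rewrite (le_trans (ga k s s0))// ler_wpM2l// a_le.
Qed.

Lemma energy_ge0 t : 0 < t -> 0 <= energy t.
Proof. by move=> t0; apply: tsum_ge0 => [k|]; [exact: a_ge0|exact: cvg_a]. Qed.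

Lemma energy_le t : 0 < t -> energy t <= M.
Proof. by move=> t0; apply: ler_tsum al_cvg _ => [|k]; [exact: cvg_a|exact: a_le]. Qed.

Lemma mode_le_energy k t : 0 < t -> a k t <= energy t.
Proof. by move=> t0; apply: (tsum_ge k (cvg_a t0)) => i; exact: a_ge0. Qed.

Lemma M_ge0 : 0 <= M.
Proof. exact: le_trans (energy_ge0 ltr01) (energy_le ltr01). Qed.

Lemma cvg_b t : 0 < t -> cvgn (series (b ^~ t)).
Proof. by move=> t0; apply: (@cvg_dom t _ 1) => // k; rewrite mul1r norm_b_le. Qed.

Lemma norm_sum_b_le t : 0 < t -> `|sum_b t| <= energy t.
Proof.
move=> t0; rewrite -[leRHS]mul1r; apply: tsum_dom => // k.
by rewrite mul1r norm_b_le.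
Qed.

Lemma v_eq t : 0 < t -> v t = (energy t - sum_b t) / 2.
Proof.
move=> t0; rewrite -tsumB; [|exact: cvg_a|exact: cvg_b].
by rewrite -v_def// mulrAC divff// mul1r.
Qed.

Lemma v_ge0 t : 0 < t -> 0 <= v t.
Proof.
move=> t0; have := norm_sum_b_le t0; rewrite v_eq// ler_norml => /andP[_].
by move=> ?; lra.
Qed.

Lemma v_le t : 0 < t -> v t <= energy t.
Proof.
move=> t0; have := norm_sum_b_le t0; rewrite v_eq// ler_norml => /andP[+ _].
by move=> ?; lra.
Qed.

Lemma v_leM t : 0 < t -> v t <= M.
Proof. by move=> t0; exact: le_trans (v_le t0) (energy_le t0). Qed.

Lemma a_sub_b k t : 0 < t -> 0 <= a k t - b k t <= 2 * a k t.
Proof.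
by move=> t0; have := norm_b_le k t0; rewrite ler_norml => /andP[? ?]; lra.
Qed.

Lemma energy_derive t : 0 < t -> is_derive t 1 energy (- (2 * v t ^+ 2)).
Proof.
move=> t0; apply: is_derive_eq.
  apply: (@is_derive_tsum_dom a (fun k t => - (v t * (a k t - b k t)))
    1 (M * 2) _ a_derive _ _ t t0).
  - by apply: mulr_ge0 => //; exact: M_ge0.
  - by move=> k s s0; rewrite mul1r ger0_norm ?a_ge0.
  - move=> k s s0; rewrite normrN -mulrA; have /andP[? ?] := a_sub_b k s0.
    by apply: ler_normM; rewrite ger0_norm ?v_ge0 ?v_leM.
rewrite (_ : (fun k => _) = fun k => - v t * (a k t - b k t)); last first.
  by apply/funext => k; rewrite mulNr.
rewrite tsumZ -?v_def//; first by ring.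
by apply: is_cvg_seriesB; [exact: cvg_a|exact: cvg_b].
Qed.

(** One constant for all the primitives of oscillating terms: the frequencies
    that they divide by are at least [mu] or at least [del]. *)
Definition osc_const := 2 / mu + 2 / del.
Local Notation K := osc_const.

Lemma osc_const_gt0 : 0 < K.
Proof. by rewrite addr_gt0// divr_gt0. Qed.

Lemma norm_mode_pairing_le k t : 0 < t -> `|mode_pairing k t| <= K * a k t.
Proof.
move=> t0; rewrite mulrC; apply: ler_normM; first exact: norm_d_le.
have l0 := lam_gt0 k.
rewrite ger0_norm ?invr_ge0 ?mulr_ge0 ?ltW//.
have : (lam k)^-1 <= mu^-1 by rewrite lef_pV2 ?posrE.
have : 0 < (lam k)^-1 by rewrite invr_gt0.
have : 0 < del^-1 by rewrite invr_gt0.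
by rewrite /osc_const !invfM; lra.
Qed.

Lemma mode_pairing_derive k t : 0 < t ->
  is_derive t 1 (mode_pairing k) (- b k t - v t * mode_pairing k t).
Proof.
move=> t0; have hd := d_derive k t0; have l0 := lam_gt0 k.
eapply is_derive_eq; first by rewrite /mode_pairing; pderiv.
by rewrite /mode_pairing /=; field; lra.
Qed.

Lemma cvg_mode_pairing t : 0 < t -> cvgn (series (mode_pairing ^~ t)).
Proof. by move=> t0; apply: (@cvg_dom t _ K) => // k; exact: norm_mode_pairing_le. Qed.

Lemma norm_pairing_le t : 0 < t -> `|pairing t| <= K * energy t.
Proof. by move=> t0; apply: tsum_dom => // k; exact: norm_mode_pairing_le. Qed.

(** The pairing is the primitive that shows that [sum_b], the difference between
    the potential and the kinetic energy, vanishes in the mean. *)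
Lemma pairing_derive t : 0 < t ->
  is_derive t 1 pairing (- sum_b t - v t * pairing t).
Proof.
move=> t0; apply: is_derive_eq.
  apply: (@is_derive_tsum_dom mode_pairing
    (fun k t => - b k t - v t * mode_pairing k t)
    K (1 + M * K) _ mode_pairing_derive _ _ t t0).
  - apply: addr_ge0; first exact: ler01.
    by apply: mulr_ge0; [exact: M_ge0|exact/ltW/osc_const_gt0].
  - by move=> k s s0; exact: norm_mode_pairing_le.
  - move=> k s s0; rewrite mulrDl mul1r -mulrA (le_trans (ler_normB _ _))//.
    rewrite normrN; apply: lerD; first exact: norm_b_le.
    apply: ler_normM; last exact: norm_mode_pairing_le.
    by rewrite ger0_norm ?v_ge0 ?v_leM.
rewrite (_ : (fun k => _) = fun k => (-1) * b k t - v t * mode_pairing k t); last first.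
  by apply/funext => k; rewrite mulN1r.
have cb := cvg_b t0; have cc := cvg_mode_pairing t0.
rewrite (tsumB (@cvg_seriesZ _ (-1) _ cb) (@cvg_seriesZ _ (v t) _ cc)).
by rewrite (tsumZ _ cb) (tsumZ _ cc) mulN1r.
Qed.

(** Primitive of [a k ^+ 2 / 2 - b k ^+ 2]: the square of a cosine has mean
    1/2. *)
Definition self_osc k t := b k t * d k t / (4 * lam k).
Definition self_osc_err k t := (a k t * d k t - b k t * d k t * 2) / (4 * lam k).

Lemma self_osc_derive k t : 0 < t -> is_derive t 1 (self_osc k)
  (a k t ^+ 2 / 2 - b k t ^+ 2 + v t * self_osc_err k t).
Proof.
move=> t0; have hd := d_derive k t0; have hb := b_derive k t0.
have l0 := lam_gt0 k.
eapply is_derive_eq; first by rewrite /self_osc; pderiv.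
by rewrite /self_osc_err -bd_a//=; field; lra.
Qed.

Lemma inv_lam_le k c : 0 < c -> (c * lam k)^-1 <= (c * mu)^-1.
Proof.
by move=> c0; rewrite lef_pV2 ?posrE ?mulr_gt0// ler_pM2l.
Qed.

Lemma norm_self_osc_le k t : 0 < t -> `|self_osc k t| <= K * a k t ^+ 2.
Proof.
move=> t0; rewrite [leRHS]mulrC expr2; apply: ler_normM.
  by apply: ler_normM; [exact: norm_b_le|exact: norm_d_le].
have l0 := lam_gt0 k.
rewrite ger0_norm ?invr_ge0 ?mulr_ge0 ?ltW//.
have := @inv_lam_le k 4 (ltr0n _ 4).
have : 0 < mu^-1 by rewrite invr_gt0.
have : 0 < del^-1 by rewrite invr_gt0.
by rewrite /osc_const !invfM; lra.
Qed.

Lemma norm_self_osc_err_le k t : 0 < t -> `|self_osc_err k t| <= K * a k t ^+ 2.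
Proof.
move=> t0.
have h : `|a k t * (d k t) - b k t * d k t * 2| <= a k t ^+ 2 * 3.
  have h1 : `|a k t * d k t| <= a k t * a k t.
    by apply: ler_normM; [rewrite ger0_norm ?a_ge0|exact: norm_d_le].
  have h2 : `|b k t * d k t| <= a k t * a k t.
    by apply: ler_normM; [exact: norm_b_le|exact: norm_d_le].
  have h3 : `|b k t * d k t * 2| = `|b k t * d k t| * 2.
    by rewrite normrM [X in _ * X]ger0_norm.
  rewrite (le_trans (ler_normB _ _))// h3 expr2; lra.
rewrite [leRHS](_ : _ = a k t ^+ 2 * 3 * (K / 3)); last by field.
apply: ler_normM => //.
have l0 := lam_gt0 k.
rewrite ger0_norm ?invr_ge0 ?mulr_ge0 ?ltW//.
have := @inv_lam_le k 4 (ltr0n _ 4).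
have : 0 < mu^-1 by rewrite invr_gt0.
have : 0 < del^-1 by rewrite invr_gt0.
by rewrite /osc_const !invfM; lra.
Qed.

(** The primitive of the product of [b i] and [b k]: the combination of the
    derivatives of [d i * b k] and [b i * d k] from which the term in
    [d i * d k] is eliminated. *)
Definition cross_osc k i t : R := if i == k then 0 else
  (lam i * (d i t * b k t) - lam k * (b i t * d k t))
  / (2 * (lam k ^+ 2 - lam i ^+ 2)).
Definition offdiag k i t : R := if i == k then 0 else b k t * b i t.
Definition cross_osc_err k i t : R := if i == k then 0 else
  (lam i * (d i t * (a k t - 2 * b k t)) - lam k * ((a i t - 2 * b i t) * d k t))
  / (2 * (lam k ^+ 2 - lam i ^+ 2)).

Lemma sqr_lam_neq i k : i != k -> lam k ^+ 2 - lam i ^+ 2 != 0.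
Proof.
move=> ik; rewrite subr_sqr mulf_neq0//.
  by rewrite -normr_gt0; apply: lt_le_trans (gap ik).
by rewrite gt_eqF// addr_gt0.
Qed.

Lemma cross_osc_derive k i t : 0 < t ->
  is_derive t 1 (cross_osc k i) (offdiag k i t + v t * cross_osc_err k i t).
Proof.
move=> t0; rewrite /cross_osc /offdiag /cross_osc_err; case: eqVneq => [_|ik].
  by eapply is_derive_eq; [pderiv|rewrite mulr0 addr0].
have di := d_derive i t0; have dk := d_derive k t0.
have bi := b_derive i t0; have bk := b_derive k t0.
have l0 := sqr_lam_neq ik.
by eapply is_derive_eq; [pderiv|rewrite /=; field].
Qed.

(** The divisor factors as (lam k - lam i)(lam k + lam i); the sum compensates
    for the frequencies in the numerator, and the gap bounds the difference. *)
Lemma small_divisor i k (x y Z : R) : i != k -> `|x| <= Z -> `|y| <= Z ->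
  `|(lam i * x - lam k * y) / (2 * (lam k ^+ 2 - lam i ^+ 2))|
    <= Z / (2 * del).
Proof.
move=> ik xZ yZ; have l0 := sqr_lam_neq ik.
have Z0 : 0 <= Z by exact: le_trans xZ.
have li := lam_gt0 i; have lk := lam_gt0 k.
rewrite normf_div ler_pdivrMr; last by rewrite normr_gt0 mulf_neq0.
have hN : `|lam i * x - lam k * y| <= (lam i + lam k) * Z.
  rewrite (le_trans (ler_normB _ _))// mulrDl; apply: lerD;
  by apply: ler_normM => //; rewrite ger0_norm// ltW.
apply: (le_trans hN).
rewrite subr_sqr !normrM [`|2|]ger0_norm// [`|lam k + lam i|]ger0_norm; last lra.
rewrite [leRHS](_ : _ = (lam i + lam k) * Z * (`|lam k - lam i| / del)); last first.
  by field; rewrite gt_eqF.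
apply: ler_peMr; first by apply: mulr_ge0 => //; lra.
by rewrite ler_pdivlMr// mul1r gap.
Qed.

Lemma norm_cross_osc_le k i t : 0 < t -> `|cross_osc k i t| <= K * a k t * a i t.
Proof.
move=> t0; have ai := a_ge0 i t0; have ak := a_ge0 k t0.
have K0 := ltW osc_const_gt0.
rewrite /cross_osc; case: eqVneq => [_|ik]; first by rewrite normr0 !mulr_ge0.
have := @small_divisor i k (d i t * b k t) (b i t * d k t) (a i t * a k t) ik.
move=> /(_ (ler_normM (norm_d_le i t0) (norm_b_le k t0))).
move=> /(_ (ler_normM (norm_b_le i t0) (norm_d_le k t0))) h.
apply: (le_trans h); rewrite [leRHS](_ : _ = a i t * a k t * K); last by ring.
apply: ler_wpM2l; first exact: mulr_ge0.
have : 0 < mu^-1 by rewrite invr_gt0.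
have : 0 < del^-1 by rewrite invr_gt0.
by rewrite /osc_const !invfM; lra.
Qed.

Lemma norm_sub2_le k t : 0 < t -> `|a k t - 2 * b k t| <= 3 * a k t.
Proof.
move=> t0; have := norm_b_le k t0.
by rewrite !ler_norml => /andP[? ?]; apply/andP; split; lra.
Qed.

Lemma norm_cross_osc_err_le k i t : 0 < t ->
  `|cross_osc_err k i t| <= K * a k t * a i t.
Proof.
move=> t0; have ai := a_ge0 i t0; have ak := a_ge0 k t0.
have K0 := ltW osc_const_gt0.
rewrite /cross_osc_err; case: eqVneq => [_|ik]; first by rewrite normr0 !mulr_ge0.
have := @small_divisor i k (d i t * (a k t - 2 * b k t))
   ((a i t - 2 * b i t) * d k t) (3 * (a i t * a k t)) ik.
rewrite {1}mulrCA => /(_ (ler_normM (norm_d_le i t0) (norm_sub2_le k t0))).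
rewrite mulrA => /(_ (ler_normM (norm_sub2_le i t0) (norm_d_le k t0))) h.
apply: (le_trans h); rewrite [leRHS](_ : _ = a i t * a k t * K); last by ring.
rewrite [leLHS](_ : _ = a i t * a k t * (3 / (2 * del))); last by ring.
apply: ler_wpM2l; first exact: mulr_ge0.
have : 0 < mu^-1 by rewrite invr_gt0.
have : 0 < del^-1 by rewrite invr_gt0.
by rewrite /osc_const !invfM; lra.
Qed.

Lemma norm_offdiag_le k i t : 0 < t -> `|offdiag k i t| <= a k t * a i t.
Proof.
move=> t0; rewrite /offdiag; case: eqVneq => _.
  by rewrite normr0 mulr_ge0 ?a_ge0.
by apply: ler_normM; exact: norm_b_le.
Qed.

Lemma tsum_offdiag k t : 0 < t ->
  tsum (fun i => offdiag k i t) = b k t * (sum_b t - b k t).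
Proof.
move=> t0; have cb := cvg_b t0.
pose diag i := if i == k then b k t ^+ 2 else 0.
have cd : cvgn (series diag).
  apply: (@cvg_dom t _ (a k t)) => // i; rewrite /diag; case: eqP => [->|_].
    by rewrite normrX -expr2 lerXn2r ?nnegrE ?norm_b_le ?a_ge0.
  by rewrite normr0 mulr_ge0 ?a_ge0.
rewrite [X in tsum X](_ : _ = fun i => b k t * b i t - diag i); last first.
  apply/funext => i; rewrite /offdiag /diag.
  by case: eqP => [->|_]; rewrite ?subr0// -expr2 subrr.
rewrite (tsumB (@cvg_seriesZ _ (b k t) _ cb) cd) (tsumZ _ cb).
rewrite (@tsum_single _ diag k); first by rewrite /diag eqxx /sum_b; ring.
by move=> i /negbTE ik; rewrite /diag ik.
Qed.

(** Primitive of the interaction of the mode [k] with all the others. *)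
Definition cross_sum k t := tsum (fun i => cross_osc k i t).
Definition cross_sum_err k t := tsum (fun i => cross_osc_err k i t).

Lemma cross_sum_derive k t : 0 < t ->
  is_derive t 1 (cross_sum k) (b k t * (sum_b t - b k t) + v t * cross_sum_err k t).
Proof.
move=> t0; eapply is_derive_eq.
  apply: (@is_derive_tsum_dom (cross_osc k)
    (fun i t => offdiag k i t + v t * cross_osc_err k i t)
    (K * M) (M + M * (K * M)) _ (cross_osc_derive k) _ _ t t0).
  - have M0 := M_ge0; have K0 := ltW osc_const_gt0.
    by apply: addr_ge0 => //; apply: mulr_ge0 => //; apply: mulr_ge0.
  - move=> i s s0; apply: le_trans (norm_cross_osc_le k i s0) _.
    apply: ler_wpM2r; first exact: a_ge0.
    apply: ler_wpM2l; first exact/ltW/osc_const_gt0.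
    exact: le_trans (mode_le_energy k s0) (energy_le s0).
  - have aM s : 0 < s -> a k s <= M.
      by move=> s0; exact: le_trans (mode_le_energy k s0) (energy_le s0).
    move=> i s s0; apply: le_trans (ler_normD _ _) _; rewrite mulrDl; apply: lerD.
      apply: le_trans (norm_offdiag_le k i s0) _.
      by apply: ler_wpM2r; [exact: a_ge0|exact: aM].
    rewrite -mulrA; apply: ler_normM.
      by rewrite ger0_norm ?v_ge0 ?v_leM.
    apply: le_trans (norm_cross_osc_err_le k i s0) _.
    apply: ler_wpM2r; first exact: a_ge0.
    by apply: ler_wpM2l; [exact/ltW/osc_const_gt0|exact: aM].
have co : cvgn (series (fun i => offdiag k i t)).
  by apply: (@cvg_dom t _ (a k t)) => // i; exact: norm_offdiag_le.
have ce : cvgn (series (fun i => cross_osc_err k i t)).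
  by apply: (@cvg_dom t _ (K * a k t)) => // i; exact: norm_cross_osc_err_le.
rewrite (tsumD co (@cvg_seriesZ _ (v t) _ ce)) (tsumZ _ ce).
by rewrite tsum_offdiag.
Qed.

Lemma norm_cross_sum_le k t : 0 < t -> `|cross_sum k t| <= K * energy t * a k t.
Proof.
move=> t0; rewrite mulrAC; apply: tsum_dom => // i; exact: norm_cross_osc_le.
Qed.

Lemma norm_cross_sum_err_le k t : 0 < t -> `|cross_sum_err k t| <= K * energy t * a k t.
Proof.
move=> t0; rewrite mulrAC; apply: tsum_dom => // i; exact: norm_cross_osc_err_le.
Qed.

(** Primitive of [sum_b ^+ 2 - sum_b_sq], the sum of [b i * b k] over all pairs of
    distinct modes. *)
Definition cross_total t := tsum (cross_sum ^~ t).
Definition cross_total_err t := tsum (cross_sum_err ^~ t).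

Lemma norm_cross_total_le t : 0 < t -> `|cross_total t| <= K * energy t ^+ 2.
Proof.
move=> t0; rewrite expr2 mulrA; apply: tsum_dom => // k; exact: norm_cross_sum_le.
Qed.

Lemma norm_cross_total_err_le t : 0 < t -> `|cross_total_err t| <= K * energy t ^+ 2.
Proof.
move=> t0; rewrite expr2 mulrA; apply: tsum_dom => // k; exact: norm_cross_sum_err_le.
Qed.

Lemma norm_b_sq_le k t : 0 < t -> `|b k t ^+ 2| <= energy t * a k t.
Proof.
move=> t0; rewrite expr2; apply: ler_normM; last exact: norm_b_le.
exact: le_trans (norm_b_le k t0) (mode_le_energy k t0).
Qed.

Lemma cvg_b_sq t : 0 < t -> cvgn (series (fun k => b k t ^+ 2)).
Proof.
by move=> t0; apply: (@cvg_dom t _ (energy t)) => // k; exact: norm_b_sq_le.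
Qed.

Lemma cross_total_derive t : 0 < t ->
  is_derive t 1 cross_total (sum_b t ^+ 2 - sum_b_sq t + v t * cross_total_err t).
Proof.
move=> t0; have M0 := M_ge0; have K0 := ltW osc_const_gt0.
eapply is_derive_eq.
  apply: (@is_derive_tsum_dom cross_sum
    (fun k t => b k t * (sum_b t - b k t) + v t * cross_sum_err k t)
    (K * M) (2 * M + M * (K * M)) _ cross_sum_derive _ _ t t0).
  - by apply: addr_ge0; apply: mulr_ge0 => //; apply: mulr_ge0.
  - move=> k s s0; apply: le_trans (norm_cross_sum_le k s0) _.
    apply: ler_wpM2r; first exact: a_ge0.
    by apply: ler_wpM2l => //; exact: energy_le.
  - move=> k s s0; apply: le_trans (ler_normD _ _) _; rewrite mulrDl; apply: lerD.
      rewrite mulrC; apply: ler_normM; last exact: norm_b_le.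
      apply: le_trans (ler_normB _ _) _.
      have := norm_sum_b_le s0; have := norm_b_le k s0.
      have := mode_le_energy k s0; have := energy_le s0; lra.
    rewrite -mulrA; apply: ler_normM.
      by rewrite ger0_norm ?v_ge0 ?v_leM.
    apply: le_trans (norm_cross_sum_err_le k s0) _.
    apply: ler_wpM2r; first exact: a_ge0.
    by apply: ler_wpM2l => //; exact: energy_le.
have cb := cvg_b t0; have cq := cvg_b_sq t0.
have ce : cvgn (series (cross_sum_err ^~ t)).
  by apply: (@cvg_dom t _ (K * energy t)) => // k; exact: norm_cross_sum_err_le.
rewrite [X in tsum X](_ : _ = fun k =>
  (sum_b t * b k t - b k t ^+ 2) + v t * cross_sum_err k t); last first.
  by apply/funext => k; congr (_ + _); ring.
have cb' := @cvg_seriesZ _ (sum_b t) _ cb.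
have cbq : cvgn (series (fun k => sum_b t * b k t - b k t ^+ 2)).
  exact: is_cvg_seriesB cb' cq.
rewrite (tsumD cbq (@cvg_seriesZ _ (v t) _ ce)) (tsumZ _ ce).
by rewrite (tsumB cb' cq) (tsumZ _ cb) -expr2.
Qed.

(** [J] is the set of excited modes. *)
Variable J : set nat.
Hypothesis J_infinite : infinite_set J.
Hypothesis a_gt0 : forall k t, J k -> 0 < t -> 0 < a k t.
Hypothesis a_eq0 : forall k t, ~ J k -> 0 < t -> a k t = 0.

Lemma energy_gt0 t : 0 < t -> 0 < energy t.
Proof.
move=> t0; have [k Jk] : exists k, J k.
  apply/set0P; apply/negP => /eqP J0; apply: J_infinite.
  by rewrite J0; exact: finite_set0.
exact: lt_le_trans (a_gt0 Jk t0) (mode_le_energy k t0).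
Qed.

Lemma energy_nincr s t : 0 < s -> s <= t -> energy t <= energy s.
Proof.
move=> s0 st; rewrite -lerN2.
apply: (@is_derive_ge0_le _ (fun t => - energy t)) => // x /andP[sx _].
have dE := energy_derive (lt_le_trans s0 sx).
exists (2 * v x ^+ 2); last by rewrite mulr_ge0// sqr_ge0.
by eapply is_derive_eq; [pderiv|rewrite opprK].
Qed.

(** The derivative of [pairing] is - energy + O(v), and v is small in the mean
    since v^2 is integrable. Were the energy to stay above 2 e, the bounded
    function F = pairing + c energy below would decrease at a rate of at least
    e. *)
Lemma energy_to0 eps : 0 < eps ->
  exists2 T, 0 < T & forall t, T <= t -> energy t <= eps.
Proof.
move=> eps0.
pose e := eps / 2; pose C := 2 + K * M; pose L := K * M + C ^+ 2 / (2 * e) * M.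
have e0 : 0 < e by rewrite /e; lra.
have M0 := M_ge0; have K0 := osc_const_gt0.
have C0 : 0 <= C by rewrite /C; have := mulr_ge0 (ltW K0) M0; lra.
have c0 : 0 <= C ^+ 2 / (2 * e).
  by rewrite divr_ge0 ?sqr_ge0// mulr_ge0// ltW.
have L0 : 0 <= L.
  by rewrite /L; have := mulr_ge0 (ltW K0) M0; have := mulr_ge0 c0 M0; lra.
pose T := 2 + 2 * L / e.
have T2 : 2 <= T by rewrite /T lerDl divr_ge0 ?mulr_ge0// ltW.
have T0 : 0 < T by lra.
exists T => // t Tt; apply: le_trans (energy_nincr T0 Tt) _.
rewrite leNgt; apply/negP => ET.
pose F t := pairing t + C ^+ 2 / (2 * e) * energy t.
have F_le s : 0 < s -> `|F s| <= L.
  move=> s0; rewrite /F (le_trans (ler_normD _ _))//; apply: lerD.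
    by apply: le_trans (norm_pairing_le s0) _; rewrite ler_wpM2l ?energy_le// ltW.
  apply: ler_normM; first by rewrite ger0_norm.
  by rewrite ger0_norm ?energy_ge0 ?energy_le.
have : - F 1 - e * 1 <= - F T - e * T.
  apply: (@is_derive_ge0_le _ (fun t => - F t - e * t)); first by lra.
  move=> x /andP[x1 xT]; have x0 : 0 < x by lra.
  have dE := energy_derive x0; have dc := pairing_derive x0.
  have di : is_derive x 1 (@id R) 1 by exact: is_derive_id.
  exists (- ((- sum_b x - v x * pairing x) + C ^+ 2 / (2 * e) * (- (2 * v x ^+ 2))) - e).
    by eapply is_derive_eq; [rewrite /F; pderiv|rewrite /=; ring].
  have Ex : 2 * e < energy x.
    by rewrite /e mulrC divfK// (lt_le_trans ET)// energy_nincr.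
  have vc : v x * pairing x <= v x * (K * M).
    apply: ler_wpM2l; first exact: v_ge0.
    apply: le_trans (ler_norm _) _; apply: le_trans (norm_pairing_le x0) _.
    by rewrite ler_wpM2l ?energy_le// ltW.
  have vc' : - (v x * (K * M)) <= v x * pairing x.
    rewrite -mulrN; apply: ler_wpM2l; first exact: v_ge0.
    rewrite lerNl; apply: le_trans (ler_norm _) _; rewrite normrN.
    apply: le_trans (norm_pairing_le x0) _.
    by rewrite ler_wpM2l ?energy_le// ltW.
  have sb : sum_b x = energy x - 2 * v x by rewrite (v_eq x0); lra.
  (* Young's inequality absorbs the linear term in v into -E' *)
  have young : C * v x <= e + C ^+ 2 * v x ^+ 2 / e.
    rewrite -subr_ge0 (_ : _ - _ = (e ^+ 2 - C * v x * e + (C * v x) ^+ 2) / e).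
      apply: divr_ge0; last exact: ltW.
      by have := sqr_ge0 (e - C * v x / 2); have := sqr_ge0 (C * v x); lra.
    by field; rewrite gt_eqF.
  have -> : C ^+ 2 / (2 * e) * - (2 * v x ^+ 2) = - (C ^+ 2 * v x ^+ 2 / e).
    by field; rewrite gt_eqF.
  by rewrite sb; move: young vc vc'; rewrite {1}/C; lra.
have := F_le 1 ltr01; have := F_le T T0.
rewrite !ler_norml => /andP[? ?] /andP[? ?].
have -> : e * T = 2 * e + 2 * L by rewrite /T; field; rewrite gt_eqF.
by lra.
Qed.

(** The corrected energy whose decay controls [energy ^+ 2] without
    oscillations. Once the energy is small, minus its derivative is thus an
    integrable majorant of the error terms, which are all O(energy ^+ 2). *)
Definition lyap t := 4 * (energy t + energy t * pairing t + cross_total t / 2).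

Lemma cubic_le t (x y z X : R) : 0 < t -> `|x| <= energy t -> `|y| <= energy t ->
  `|z| <= X -> `|x * y * z| <= energy t ^+ 2 * X.
Proof. by move=> t0 hx hy hz; rewrite expr2; do 2 apply: ler_normM => //. Qed.

Lemma norm_v_le t : 0 < t -> `|v t| <= energy t.
Proof. by move=> t0; rewrite ger0_norm ?v_ge0 ?v_le. Qed.

Lemma norm_energy_le t : 0 < t -> `|energy t| <= energy t.
Proof. by move=> t0; rewrite ger0_norm ?energy_ge0. Qed.

Lemma sum_b_sq_ge0 t : 0 < t -> 0 <= sum_b_sq t.
Proof. by move=> t0; apply: tsum_ge0 (cvg_b_sq t0) => k; exact: sqr_ge0. Qed.

Lemma lyap_derive t : 0 < t -> 14 * K * energy t <= 1 ->
  exists2 D, is_derive t 1 lyap D & D <= - energy t ^+ 2.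
Proof.
move=> t0 small; have E0 := energy_ge0 t0; have K0 := osc_const_gt0.
have dE := energy_derive t0; have dc := pairing_derive t0.
have dT := cross_total_derive t0.
exists (4 * (- energy t ^+ 2 / 2 - sum_b_sq t / 2 - 2 * (v t * v t * pairing t)
   - v t * energy t * pairing t + v t * cross_total_err t / 2)).
  eapply is_derive_eq; first by rewrite /lyap; pderiv.
  by rewrite /= (v_eq t0); field.
have h1 := cubic_le t0 (norm_v_le t0) (norm_v_le t0) (norm_pairing_le t0).
have h2 := cubic_le t0 (norm_v_le t0) (norm_energy_le t0) (norm_pairing_le t0).
have h3 : `|v t * cross_total_err t| <= energy t ^+ 2 * (K * energy t).
  rewrite expr2 -mulrA; apply: ler_normM; first exact: norm_v_le.
  by rewrite mulrCA -expr2; exact: norm_cross_total_err_le.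
have h4 : energy t ^+ 2 * (K * energy t) <= energy t ^+ 2 / 14.
  by apply: ler_wpM2l; [exact: sqr_ge0|lra].
have := sum_b_sq_ge0 t0.
by move: h1 h2 h3; rewrite !ler_norml => /andP[? ?] /andP[? ?] /andP[? ?]; lra.
Qed.

Lemma norm_lyap_le t : 0 < t -> 14 * K * energy t <= 1 ->
  K * `|lyap t| <= 5 / 14.
Proof.
move=> t0 small; have E0 := energy_ge0 t0; have K0 := osc_const_gt0.
have h1 : `|energy t * pairing t| <= energy t * (K * energy t).
  by apply: ler_normM; [exact: norm_energy_le|exact: norm_pairing_le].
have h2 := norm_cross_total_le t0.
have h3 : energy t * (K * energy t) <= energy t / 14.
  by apply: ler_wpM2l => //; lra.
have h4 : K * energy t ^+ 2 <= energy t / 14 by rewrite expr2 mulrCA.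
have : `|lyap t| <= 5 * energy t.
  move: h1 h2; rewrite /lyap !ler_norml => /andP[? ?] /andP[? ?].
  by apply/andP; split; lra.
by move=> /(ler_wpM2l (ltW K0)); lra.
Qed.

Lemma norm_div_le (x c y : R) : 0 < y -> `|x| <= c * y -> `|x / y| <= c.
Proof. by move=> y0 h; rewrite normf_div (gtr0_norm y0) ler_pdivrMr. Qed.

(** The oscillating part of [ln (a k)]: half the sum of the primitives of
    [sum_b], [energy * b k / a k], [b k ^+ 2 / a k] and of the interaction terms,
    with their signs in the equation for [a k]. *)
Definition log_correction k t := (- pairing t - energy t * mode_pairing k t / a k t
  + self_osc k t / a k t - cross_sum k t / a k t) / 2.

Lemma norm_log_correction_le k t : J k -> 0 < t ->
  `|log_correction k t| <= 2 * K * energy t.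
Proof.
move=> Jk t0; have a0 := a_gt0 Jk t0; have E0 := energy_ge0 t0.
have K0 := osc_const_gt0; have aE := mode_le_energy k t0.
have h1 := norm_pairing_le t0.
have h2 : `|energy t * mode_pairing k t / a k t| <= K * energy t.
  apply: norm_div_le => //.
    rewrite [leRHS](_ : _ = energy t * (K * a k t)); last by ring.
    apply: ler_normM.
    exact: norm_energy_le.
  exact: norm_mode_pairing_le.
have h3 : `|self_osc k t / a k t| <= K * energy t.
  apply: norm_div_le => //; apply: le_trans (norm_self_osc_le k t0) _.
  by rewrite expr2 mulrA ler_wpM2r ?ler_wpM2l// ltW.
have h4 : `|cross_sum k t / a k t| <= K * energy t.
  by apply: norm_div_le => //; exact: norm_cross_sum_le.
move: h1 h2 h3 h4; rewrite /log_correction !ler_norml.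
move=> /andP[? ?] /andP[? ?] /andP[? ?] /andP[? ?].
by apply/andP; split; lra.
Qed.

(** The averaged equation of a mode. All the errors carry a factor [v], and they
    are divided by [a k] only after being bounded by a multiple of [a k], so that
    the constant is the same for all modes. *)
Lemma log_mode_derive k t : J k -> 0 < t ->
  exists2 D, is_derive t 1 (fun s => ln (a k s) - log_correction k s) D &
    `|D + energy t / 2 + a k t / 4| <= 6 * K * energy t ^+ 2.
Proof.
move=> Jk t0; have a0 := a_gt0 Jk t0; have E0 := energy_ge0 t0.
have K0 := osc_const_gt0; have aE := mode_le_energy k t0.
have an0 : a k t != 0 by rewrite gt_eqF.
have da := a_derive k t0; have dE := energy_derive t0; have dc := pairing_derive t0.
have d1 := mode_pairing_derive k t0; have ds := self_osc_derive k t0.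
have dosc := cross_sum_derive k t0.
pose x := mode_pairing k t / a k t; pose q := self_osc_err k t / a k t.
pose s := cross_sum_err k t / a k t; pose Q := self_osc k t / a k t.
pose S := cross_sum k t / a k t; pose y := (a k t - b k t) / a k t.
pose err := - pairing t / 2 - energy t * x / 2 - q / 2 + s / 2 - v t * x
   + (energy t * x - Q + S) * y / 2.
exists (- energy t / 2 - a k t / 4 + v t * err).
  eapply is_derive_eq; first by rewrite /log_correction; pderiv.
  by rewrite /err /x /q /s /Q /S /y /= (v_eq t0); field.
rewrite (_ : _ + _ + _ = v t * err); last by lra.
rewrite (_ : 6 * K * energy t ^+ 2 = energy t * (6 * K * energy t)); last by ring.
apply: ler_normM; first exact: norm_v_le.
have hx : `|x| <= K by apply: norm_div_le => //; exact: norm_mode_pairing_le.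
have hq : `|q| <= K * energy t.
  apply: norm_div_le => //; apply: le_trans (norm_self_osc_err_le k t0) _.
  by rewrite expr2 mulrA ler_wpM2r ?ler_wpM2l// ltW.
have hs : `|s| <= K * energy t by apply: norm_div_le => //; exact: norm_cross_sum_err_le.
have hQ : `|Q| <= K * energy t.
  apply: norm_div_le => //; apply: le_trans (norm_self_osc_le k t0) _.
  by rewrite expr2 mulrA ler_wpM2r ?ler_wpM2l// ltW.
have hS : `|S| <= K * energy t by apply: norm_div_le => //; exact: norm_cross_sum_le.
have hy : `|y| <= 2.
  have /andP[? ?] := a_sub_b k t0.
  by apply: norm_div_le => //; rewrite ger0_norm.
have hEx : `|energy t * x| <= energy t * K.
  by apply: ler_normM => //; exact: norm_energy_le.
have hvx : `|v t * x| <= energy t * K.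
  by apply: ler_normM => //; exact: norm_v_le.
have hz : `|(energy t * x - Q + S) * y| <= (3 * K * energy t) * 2.
  apply: ler_normM => //; move: hEx hQ hS; rewrite !ler_norml.
  by move=> /andP[? ?] /andP[? ?] /andP[? ?]; apply/andP; split; lra.
have hc := norm_pairing_le t0.
move: hc hEx hq hs hvx hz; rewrite /err !ler_norml.
move=> /andP[? ?] /andP[? ?] /andP[? ?] /andP[? ?] /andP[? ?] /andP[? ?].
by apply/andP; split; lra.
Qed.

(** * Equipartition between the excited modes *)
Section Comparison.
Variables (t0 e3 : R) (I p P : R -> R) (z : R -> nat -> R -> R).
(** [I] is a primitive of the energy, [p] the common factor exp(- I / 2) of all
    the modes and [P] a primitive of [p]. The function [z sg k] is p / a k times a
    factor between 1 / e3 and e3. This factor removes the oscillations, and the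
    term in [lyap] absorbs the remaining errors, so that z' is at most e3 p for
    [sg = 1], and at least p / (4 e3) for [sg = -1]. *)
Hypothesis t0_gt0 : 0 < t0.
Hypothesis small : forall t, t0 <= t -> 14 * K * energy t <= 1.
Hypothesis I_derive : forall t, t0 <= t -> is_derive t 1 I (energy t).
Hypothesis p_def : forall t, p t = expR (- (I t / 2)).
Hypothesis P_derive : forall t, t0 <= t -> is_derive t 1 P (p t).
Hypothesis e3_def : e3 = expR 3.
Hypothesis z_def : forall sg k t, z sg k t =
  expR (- (ln (a k t) - log_correction k t) + - (I t * 2^-1) + sg * (6 * K * lyap t)).

Let gt0 t : t0 <= t -> 0 < t. Proof. exact: lt_le_trans. Qed.
Let e3_ge1 : 1 <= e3. Proof. by rewrite e3_def -[leLHS]expR0 ler_expR. Qed.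
Let e3_gt0 : 0 < e3. Proof. by rewrite e3_def expR_gt0. Qed.
Let e3_ge0 : 0 <= e3. Proof. exact: ltW. Qed.
Let e3X_ge0 n : 0 <= e3 ^+ n. Proof. exact: exprn_ge0. Qed.
Let p_gt0 t : 0 < p t. Proof. by rewrite p_def expR_gt0. Qed.
Let n1 : `|1 : R| <= 1. Proof. by rewrite normr1. Qed.
Let nN1 : `|-1 : R| <= 1. Proof. by rewrite normrN1. Qed.

Let P_ndecr s t : t0 <= s -> s <= t -> P s <= P t.
Proof.
move=> s0 st; apply: is_derive_ge0_le => // x /andP[sx _].
by exists (p x); [exact/P_derive/(le_trans s0)|exact/ltW].
Qed.

Let z_gt0 sg k t : 0 < z sg k t. Proof. by rewrite z_def expR_gt0. Qed.

Let z_mode sg k t : J k -> `|sg| <= 1 -> t0 <= t ->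
  p t <= e3 * (z sg k t * a k t) /\ z sg k t * a k t <= e3 * p t.
Proof.
move=> Jk sg1 tt; have t_gt0 := gt0 tt; have ak := a_gt0 Jk t_gt0.
have -> : z sg k t * a k t =
    p t * expR (log_correction k t + sg * (6 * K * lyap t)).
  by rewrite z_def p_def -{2}(lnK ak) -!expRD; congr expR; ring.
have : `|log_correction k t + sg * (6 * K * lyap t)| <= 3.
  apply: le_trans (ler_normD _ _) _.
  have h1 := norm_log_correction_le Jk t_gt0; have sm := small tt.
  have h2 : `|sg * (6 * K * lyap t)| <= 1 * (6 * (5 / 14)).
    apply: ler_normM => //; rewrite -mulrA normrM ger0_norm//.
    rewrite ler_wpM2l// normrM (gtr0_norm osc_const_gt0).
    exact: norm_lyap_le.
  by lra.
rewrite ler_norml => /andP[h1 h2]; split.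
  rewrite mulrCA; apply: ler_peMr; first exact: ltW.
  by rewrite e3_def -expRD -[leLHS]expR0 ler_expR; lra.
by rewrite mulrC ler_pM2r// e3_def ler_expR.
Qed.

Let z_plus_le k t : J k -> t0 <= t ->
  z 1 k t <= z 1 k t0 + e3 * (P t - P t0).
Proof.
move=> Jk tt.
suff : e3 * P t0 - z 1 k t0 <= e3 * P t - z 1 k t by lra.
apply: (@is_derive_ge0_le _ (fun s => e3 * P s - z 1 k s)) => // x /andP[xt _].
have x0 := gt0 xt; have dI := I_derive xt; have dP := P_derive xt.
have [Dl dl Dl_le] := lyap_derive x0 (small xt).
have [Dm dm Dm_le] := log_mode_derive Jk x0.
have zE : z 1 k = fun s => expR (- (ln (a k s) - log_correction k s)
    + - (I s * 2^-1) + 1 * (6 * K * lyap s)) by apply/funext.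
exists (e3 * p x - (- Dm - energy x / 2 + 6 * K * Dl) * z 1 k x).
  by rewrite zE; eapply is_derive_eq; [pderiv|rewrite /=; ring].
have K0 := osc_const_gt0.
have h : - Dm - energy x / 2 + 6 * K * Dl <= a k x / 4.
  move: Dm_le; rewrite ler_norml => /andP[h _].
  have := ler_wpM2l (ltW K0) Dl_le; lra.
have [_ hz] := z_mode Jk n1 xt.
have := ler_wpM2r (ltW (z_gt0 1 k x)) h.
have := p_gt0 x; have := mulr_gt0 e3_gt0 (p_gt0 x); lra.
Qed.

Let z_minus_ge k t : J k -> t0 <= t ->
  z (-1) k t0 + (P t - P t0) / (4 * e3) <= z (-1) k t.
Proof.
move=> Jk tt.
suff : z (-1) k t0 - (4 * e3)^-1 * P t0 <= z (-1) k t - (4 * e3)^-1 * P t by lra.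
apply: (@is_derive_ge0_le _ (fun s => z (-1) k s - (4 * e3)^-1 * P s)) => //.
move=> x /andP[xt _].
have x0 := gt0 xt; have dI := I_derive xt; have dP := P_derive xt.
have [Dl dl Dl_le] := lyap_derive x0 (small xt).
have [Dm dm Dm_le] := log_mode_derive Jk x0.
have zE : z (-1) k = fun s => expR (- (ln (a k s) - log_correction k s)
    + - (I s * 2^-1) + -1 * (6 * K * lyap s)) by apply/funext.
exists ((- Dm - energy x / 2 - 6 * K * Dl) * z (-1) k x - (4 * e3)^-1 * p x).
  by rewrite zE; eapply is_derive_eq; [pderiv|rewrite /=; ring].
have K0 := osc_const_gt0.
have h : a k x / 4 <= - Dm - energy x / 2 - 6 * K * Dl.
  move: Dm_le; rewrite ler_norml => /andP[_ h].
  have := ler_wpM2l (ltW K0) Dl_le; lra.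
have [hz _] := z_mode Jk nN1 xt.
have := ler_wpM2r (ltW (z_gt0 (-1) k x)) h.
have : (4 * e3)^-1 * p x <= (4 * e3)^-1 * (e3 * (z (-1) k x * a k x)).
  by rewrite ler_wpM2l// invr_ge0 mulr_ge0// ltW.
have -> : (4 * e3)^-1 * (e3 * (z (-1) k x * a k x)) = z (-1) k x * a k x / 4.
  by field; rewrite gt_eqF.
lra.
Qed.

Let mode_lower k t : J k -> t0 <= t ->
  p t <= e3 * (z 1 k t0 + e3 * (P t - P t0)) * a k t.
Proof.
move=> Jk tt; have ak := a_gt0 Jk (gt0 tt).
have [h _] := z_mode Jk n1 tt.
apply: (le_trans h); rewrite -mulrA ler_pM2l// ler_pM2r//; exact: z_plus_le.
Qed.

Let mode_upper k t : J k -> t0 <= t ->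
  (z (-1) k t0 + (P t - P t0) / (4 * e3)) * a k t <= e3 * p t.
Proof.
move=> Jk tt; have ak := a_gt0 Jk (gt0 tt).
have [_ h] := z_mode Jk nN1 tt.
by apply: le_trans h; rewrite ler_pM2r//; exact: z_minus_ge.
Qed.

(** If [p] were integrable, so would the energy be, but the energy decays no
    faster than 1 / t. The lower bound comes from the monotonicity of [z (-1) k],
    summed over the modes. *)
Let energy_le_p : exists2 c, 0 < c & forall t, t0 <= t -> c * energy t <= p t.
Proof.
have E0 := energy_gt0 t0_gt0.
exists (p t0 / (e3 ^+ 2 * energy t0)).
  by rewrite divr_gt0// mulr_gt0// exprn_gt0.
move=> t tt; rewrite mulrAC ler_pdivrMr; last by rewrite mulr_gt0// exprn_gt0.
rewrite mulrA.
have ca := cvg_a (gt0 tt); have ca0 := cvg_a t0_gt0.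
rewrite -(tsumZ (p t0) ca) -(tsumZ _ ca0).
apply: ler_tsum; [exact: cvg_seriesZ|exact: cvg_seriesZ|move=> k].
have [Jk|Jk] := pselect (J k); last first.
  rewrite (a_eq0 Jk (gt0 tt)) mulr0.
  by apply: mulr_ge0; [apply: mulr_ge0 => //; exact: ltW|exact: a_ge0].
have ak := a_gt0 Jk (gt0 tt); have ak0 := a_gt0 Jk t0_gt0.
have [h _] := z_mode Jk nN1 (lexx t0).
have h1 : z (-1) k t0 * a k t <= e3 * p t.
  apply: le_trans (mode_upper Jk tt); rewrite ler_pM2r// lerDl.
  apply: divr_ge0; first by rewrite subr_ge0 P_ndecr.
  exact: mulr_ge0.
apply: (le_trans (ler_wpM2r (ltW ak) h)).
rewrite [leLHS](_ : _ = (e3 * a k t0) * (z (-1) k t0 * a k t)); last by ring.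
rewrite [leRHS](_ : _ = (e3 * a k t0) * (e3 * p t)); last by ring.
by apply: ler_wpM2l => //; apply: mulr_ge0 => //; exact: ltW.
Qed.

(** [P + c / 2 * ln energy] is nondecreasing because energy' >= - 2 energy^2, and
    [ln energy] tends to -oo. *)
Let P_unbounded L : exists2 T, t0 <= T & forall t, T <= t -> L <= P t - P t0.
Proof.
have [c c0 cp] := energy_le_p.
have E0 := energy_gt0 t0_gt0.
have [T T0 hT] := energy_to0 (mulr_gt0 E0 (expR_gt0 (- (2 * L / c)))).
exists (Num.max t0 T); first by rewrite le_max lexx.
move=> t; rewrite ge_max => /andP[tt Tt].
have Et := energy_gt0 (gt0 tt).
have hln : ln (energy t) <= ln (energy t0) - 2 * L / c.
  rewrite -(expRK (- (2 * L / c))) -lnM ?posrE ?expR_gt0//.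
  by rewrite ler_ln ?posrE ?mulr_gt0 ?expR_gt0// hT.
have : P t0 + c / 2 * ln (energy t0) <= P t + c / 2 * ln (energy t).
  apply: (@is_derive_ge0_le _ (fun s => P s + c / 2 * ln (energy s))) => // x /andP[xt _].
  have x0 := gt0 xt; have dP := P_derive xt; have dE := energy_derive x0.
  have Ex := energy_gt0 x0.
  exists (p x - c * (v x ^+ 2 / energy x)).
    by eapply is_derive_eq; [pderiv|rewrite /=; field; rewrite gt_eqF].
  rewrite subr_ge0; apply: le_trans (cp x xt); rewrite ler_pM2l//.
  rewrite ler_pdivrMr// -expr2 ler_sqr ?nnegrE; [exact: v_le|exact: v_ge0|].
  exact: ltW.
have : c / 2 * ln (energy t) <= c / 2 * ln (energy t0) - L.
  have -> : L = c / 2 * (2 * L / c) by field; rewrite gt_eqF.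
  by rewrite -mulrBr ler_wpM2l// divr_ge0// ltW.
lra.
Qed.

Let J_unbounded_count N : exists n,
  (N%:R : R) <= \sum_(0 <= k < n) (if `[<J k>] then 1 else 0).
Proof.
elim: N => [|N [n hn]]; first by exists 0%N; rewrite big_nil.
have [k nk Jk] : exists2 k, (n <= k)%N & J k.
  apply: contra_notP J_infinite => h; apply: sub_finite_set (finite_II n).
  move=> k Jk /=; rewrite ltnNge; apply/negP => nk; apply: h; by exists k.
exists k.+1; rewrite big_nat_recr//= (asboolT Jk) (@big_cat_nat _ _ _ n 0 k)//= -natr1.
rewrite lerD2r (le_trans hn)// lerDl sumr_ge0// => i _; by case: ifP.
Qed.

(** Compared at a time when [P - P t0] exceeds the initial values of [z 1] for
    [N] given excited modes, each of them has at least the energy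
    p / (2 e3^2 (P - P t0)), while no mode has more than 4 e3^2 p / (P - P t0).
    Hence no mode has more than 8 e3^4 / N times the total energy. *)
Lemma sup_mode_negligible_from eps : 0 < eps ->
  exists2 T, t0 <= T & forall t k, T <= t -> a k t <= eps * energy t.
Proof.
move=> eps0.
have q0 : 0 <= 8 * e3 ^+ 4 / eps.
  by apply: divr_ge0; [exact: mulr_ge0|exact: ltW].
have := archi_boundP q0; set N := Num.bound _ => hN.
have [n hn] := J_unbounded_count N.
pose Z := \sum_(0 <= k < n) z 1 k t0.
have zZ k : (k < n)%N -> z 1 k t0 <= Z.
  move=> kn; rewrite /Z (bigD1_seq k) ?mem_index_iota ?iota_uniq//=.
  by rewrite lerDl sumr_ge0// => i _; exact: ltW.
have Z0 : 0 <= Z by rewrite sumr_ge0// => i _; exact: ltW.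
have [T T0 hT] := P_unbounded (Z + 1).
exists T => // t h Tt; have tt := le_trans T0 Tt.
have t_gt0 := gt0 tt; have pt := p_gt0 t; have Et := energy_ge0 t_gt0.
have [Jh|Jh] := pselect (J h); last first.
  by rewrite (a_eq0 Jh t_gt0) mulr_ge0// ltW.
set dP := P t - P t0; have dPZ : Z + 1 <= dP by exact: hT.
have dP0 : 0 < dP by lra.
have Ep : N%:R * p t <= 2 * e3 ^+ 2 * dP * energy t.
  apply: (@le_trans _ _ (2 * e3 ^+ 2 * dP * \sum_(0 <= k < n) a k t)); last first.
    apply: ler_wpM2l.
      by apply: mulr_ge0; [exact: mulr_ge0|exact: ltW].
    by apply: ler_sum_tsum (cvg_a t_gt0) _ => k; exact: a_ge0.
  apply: (@le_trans _ _ ((\sum_(0 <= k < n) (if `[<J k>] then 1 else 0)) * p t)).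
    by rewrite ler_pM2r.
  rewrite mulr_suml mulr_sumr !big_nat; apply: ler_sum => k /andP[_ kn].
  case: asboolP => [Jk|_]; last first.
    rewrite mul0r; apply: mulr_ge0; last exact: a_ge0.
    by apply: mulr_ge0; [exact: mulr_ge0|exact: ltW].
  rewrite mul1r; apply: (le_trans (mode_lower Jk tt)); rewrite -/dP.
  apply: ler_wpM2r; first exact: a_ge0.
  rewrite [leRHS](_ : _ = e3 * (2 * e3 * dP)); last by ring.
  rewrite ler_pM2l//.
  have := ler_wpM2r (ltW dP0) e3_ge1; have := zZ k kn; lra.
have hu : dP * a h t <= 4 * e3 ^+ 2 * p t.
  have : dP / (4 * e3) * a h t <= e3 * p t.
    apply: le_trans (mode_upper Jh tt); rewrite ler_wpM2r ?a_ge0// lerDr.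
    exact: ltW.
  have e40 : 0 <= 4 * e3 by exact: mulr_ge0.
  move=> /(ler_wpM2l e40).
  rewrite (_ : 4 * e3 * (dP / (4 * e3) * a h t) = dP * a h t); last first.
    by field; rewrite gt_eqF.
  by rewrite (_ : 4 * e3 * (e3 * p t) = 4 * e3 ^+ 2 * p t)//; ring.
have N0 : 0 < N%:R :> R by exact: le_lt_trans hN.
have hNeps : 8 * e3 ^+ 4 <= N%:R * eps.
  by rewrite -ler_pdivrMr//; exact: ltW.
rewrite -(ler_pM2l (mulr_gt0 N0 dP0)).
have s1 : N%:R * dP * a h t <= 4 * e3 ^+ 2 * (N%:R * p t).
  by have := ler_wpM2l (ltW N0) hu; lra.
apply: (le_trans s1).
have e40 : 0 <= 4 * e3 ^+ 2 by exact: mulr_ge0.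
apply: (le_trans (ler_wpM2l e40 Ep)).
have dE0 : 0 <= dP * energy t by apply: mulr_ge0 => //; exact: ltW.
have := ler_wpM2r dE0 hNeps.
by rewrite (_ : 8 * e3 ^+ 4 * _ = 4 * e3 ^+ 2 * (2 * e3 ^+ 2 * dP * energy t));
  [lra|ring].
Qed.

End Comparison.

Lemma sup_mode_negligible eps : 0 < eps ->
  exists2 T, 0 < T & forall t k, T <= t -> a k t <= eps * energy t.
Proof.
move=> eps0; have K0 := osc_const_gt0.
have K14 : 0 < (14 * K)^-1 by rewrite invr_gt0 mulr_gt0.
have [t0 t0_gt0 ht0] := energy_to0 K14.
have cE t : 0 < t -> {for t, continuous energy}.
  move=> t_gt0; apply: differentiable_continuous; apply/derivable1_diffP.
  by have [] := energy_derive t_gt0.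
have t3 : 0 < t0 / 3 by lra.
have [I dI] := antiderivative cE t3.
have cp t : t0 / 3 < t -> {for t, continuous (fun s => expR (- (I s / 2)))}.
  move=> tt; have dIt := dI t tt.
  have : is_derive t 1 (fun s => expR (- (I s / 2)))
      (- (energy t / 2) * expR (- (I t / 2))).
    by eapply is_derive_eq; [pderiv|rewrite /= mulr0 addr0].
  by move=> [dp _]; apply: differentiable_continuous; apply/derivable1_diffP.
have t2 : t0 / 3 < t0 / 2 by lra.
have [P dP] := antiderivative cp t2.
have [||||||||T T0 hT] := @sup_mode_negligible_from t0 (expR 3) I
  (fun s => expR (- (I s / 2))) P
  (fun sg k t => expR (- (ln (a k t) - log_correction k t) + - (I t * 2^-1)
    + sg * (6 * K * lyap t))) _ _ _ _ _ _ _ eps.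
- exact: t0_gt0.
- move=> t tt; have := ht0 t tt.
  by rewrite -[(14 * K)^-1]mulr1 ler_pdivlMl ?mulr_gt0.
- by move=> t tt; apply: dI; lra.
- by [].
- by move=> t tt; apply: dP; lra.
- by [].
- by [].
- exact: eps0.
by exists T => //; exact: lt_le_trans T0.
Qed.

(** The derivative of the corrected inverse energy [Y] differs from 1/2 by
    sum_k b_k^2 / (2 E^2), which is at most half the share of the largest mode,
    and by O(v). *)
Lemma inv_energy_asymp eps : 0 < eps ->
  exists2 T, 0 < T & forall t, T <= t -> `|(t * energy t)^-1 - 2^-1| <= eps.
Proof.
move=> eps0; have K0 := osc_const_gt0.
(* The errors in Y' amount to 6 K v: this makes them at most eps / 4, and the
   contribution of the largest mode is at most eps / 4 as well. *)
have eps1 : 0 < eps / (24 * K) by rewrite divr_gt0// mulr_gt0.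
have eps2 : 0 < eps / 2 by lra.
have [T1 T1_gt0 hT1] := energy_to0 eps1.
have [T2 T2_gt0 hT2] := sup_mode_negligible eps2.
pose T := Num.max T1 T2.
have T0 : 0 < T by rewrite lt_max T1_gt0.
pose Y t := (1 - pairing t) / energy t - cross_total t / (2 * energy t ^+ 2).
have dY t : T <= t -> exists2 D, is_derive t 1 Y D & `|D - 2^-1| <= eps / 2.
  rewrite ge_max => /andP[T1t T2t]; have t_gt0 := lt_le_trans T1_gt0 T1t.
  have E0 := energy_gt0 t_gt0; have En0 : energy t != 0 by rewrite gt_eqF.
  have dE := energy_derive t_gt0; have dc := pairing_derive t_gt0.
  have dT := cross_total_derive t_gt0.
  pose err := - (cross_total_err t / energy t ^+ 2) / 2 + pairing t / energy t
    - 2 * (v t / energy t * (pairing t / energy t))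
    - 2 * (v t / energy t * (cross_total t / energy t ^+ 2)).
  exists (2^-1 + sum_b_sq t / energy t ^+ 2 / 2 + v t * err).
    have -> : Y = fun s => (1 + - pairing s) * (energy s)^-1
       + - (cross_total s * (2 * (energy s * energy s))^-1) by [].
    eapply is_derive_eq; first by pderiv; rewrite /= ?mulf_neq0.
    by rewrite /err /= (v_eq t_gt0); field.
  have hE := hT1 t T1t.
  have hb : 0 <= sum_b_sq t / energy t ^+ 2 <= eps / 2.
    apply/andP; split; first by rewrite divr_ge0 ?sum_b_sq_ge0 ?sqr_ge0.
    rewrite ler_pdivrMr ?exprn_gt0// expr2 mulrA -(tsumZ _ (cvg_a t_gt0)).
    apply: ler_tsum (cvg_b_sq t_gt0) (cvg_seriesZ (cvg_a t_gt0)) _ => k.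
    have ab : b k t ^+ 2 <= a k t ^+ 2 by rewrite -bd_a// lerDl sqr_ge0.
    by rewrite (le_trans ab)// expr2 ler_wpM2r ?a_ge0// hT2.
  have hv : `|v t / energy t| <= 1.
    by apply: norm_div_le => //; rewrite mul1r norm_v_le.
  have hc : `|pairing t / energy t| <= K.
    by apply: norm_div_le => //; exact: norm_pairing_le.
  have ht : `|cross_total t / energy t ^+ 2| <= K.
    by apply: norm_div_le; [rewrite exprn_gt0|exact: norm_cross_total_le].
  have he : `|cross_total_err t / energy t ^+ 2| <= K.
    by apply: norm_div_le; [rewrite exprn_gt0|exact: norm_cross_total_err_le].
  have h1 := ler_normM hv hc; have h2 := ler_normM hv ht.
  have herr : `|err| <= 6 * K.
    move: hc he h1 h2; rewrite /err !ler_norml.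
    move=> /andP[? ?] /andP[? ?] /andP[? ?] /andP[? ?].
    by apply/andP; split; lra.
  have := ler_normM (norm_v_le t_gt0) herr.
  have -> : energy t * (6 * K) = (energy t * (24 * K)) / 4 by field.
  move: hE; rewrite ler_pdivlMr ?mulr_gt0// => hE.
  move: hb; rewrite !ler_norml => /andP[? ?] /andP[? ?].
  by apply/andP; split; lra.
have Yup t : T <= t -> Y t - Y T <= (2^-1 + eps / 2) * (t - T).
  move=> Tt.
  suff : (2^-1 + eps / 2) * T - Y T <= (2^-1 + eps / 2) * t - Y t by lra.
  apply: (@is_derive_ge0_le _ (fun s => (2^-1 + eps / 2) * s - Y s)) => // x /andP[Tx _].
  have [D dYx hD] := dY x Tx; have di : is_derive x 1 (@id R) 1 by exact: is_derive_id.
  exists (2^-1 + eps / 2 - D).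
    by eapply is_derive_eq; [pderiv|rewrite /=; ring].
  by move: hD; rewrite ler_norml => /andP[? ?]; lra.
have Ylo t : T <= t -> (2^-1 - eps / 2) * (t - T) <= Y t - Y T.
  move=> Tt.
  suff : Y T - (2^-1 - eps / 2) * T <= Y t - (2^-1 - eps / 2) * t by lra.
  apply: (@is_derive_ge0_le _ (fun s => Y s - (2^-1 - eps / 2) * s)) => // x /andP[Tx _].
  have [D dYx hD] := dY x Tx; have di : is_derive x 1 (@id R) 1 by exact: is_derive_id.
  exists (D - (2^-1 - eps / 2)).
    by eapply is_derive_eq; [pderiv|rewrite /=; ring].
  by move: hD; rewrite ler_norml => /andP[? ?]; lra.
have Yinv t : 0 < t -> `|(energy t)^-1 - Y t| <= 2 * K.
  move=> t_gt0; have E0 := energy_gt0 t_gt0.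
  have -> : (energy t)^-1 - Y t =
      pairing t / energy t + cross_total t / energy t ^+ 2 / 2.
    by rewrite /Y; field; rewrite gt_eqF.
  have hc : `|pairing t / energy t| <= K.
    by apply: norm_div_le => //; exact: norm_pairing_le.
  have ht : `|cross_total t / energy t ^+ 2| <= K.
    by apply: norm_div_le; [rewrite exprn_gt0|exact: norm_cross_total_le].
  move: hc ht; rewrite !ler_norml => /andP[? ?] /andP[? ?].
  by apply/andP; split; lra.
pose C := 2 * K + `|Y T| + T.
have C0 : 0 < C by rewrite /C; have := normr_ge0 (Y T); lra.
exists (Num.max T (2 * C / eps + (eps + 1) * T)).
  by rewrite lt_max T0.
move=> t; rewrite ge_max => /andP[Tt Ct]; have t_gt0 := lt_le_trans T0 Tt.
have E0 := energy_gt0 t_gt0.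
have -> : (t * energy t)^-1 - 2^-1 = ((energy t)^-1 - t / 2) / t.
  by field; rewrite !gt_eqF.
apply: norm_div_le => //.
have hC : 2 * C + eps * ((eps + 1) * T) <= eps * t.
  have := ler_wpM2l (ltW eps0) Ct.
  by rewrite mulrDr (_ : eps * (2 * C / eps) = 2 * C)//; field; rewrite gt_eqF.
have eT : 0 <= eps * (eps * T) by rewrite !mulr_ge0// ltW.
have eT' : 0 <= eps * T by rewrite mulr_ge0// ltW.
have := Yup t Tt; have := Ylo t Tt; have := Yinv t t_gt0.
have := ler_norm (Y T); have := ler_norm (- Y T); rewrite normrN.
move: hC; rewrite /C !ler_norml => hC ? ? /andP[? ?] ? ?.
by apply/andP; split; lra.
Qed.

Lemma mode_system_asymp : t * energy t @[t --> +oo] --> (2 : R).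
Proof.
have h : (t * energy t)^-1 @[t --> +oo] --> (2^-1 : R).
  apply/cvgrPdist_le => eps eps0.
  have [T T0 hT] := inv_energy_asymp eps0.
  near=> t; rewrite distrC; apply: hT; near: t.
  by apply: nbhs_pinfty_ge; exact: num_real.
have n0 : (2 : R) != 0 by [].
exact/(cvgVP _ n0).
Unshelve. all: by end_near. Qed.

End ModeSystem.

(** * Reduction to the system of modes *)
Section HalfLineCalculus.
Context {R : realType}.
Implicit Types (t s : R).

Lemma cvg_quot_ge0 {V : normedModType R} (f : R -> V) t :
  derivable_ge0 f -> 0 < t ->
  h^-1 *: (f (t + h) - f t) @[h --> (0 : R)^'] --> derive_ge0 f t.
Proof.
move=> df t0; have ct := df t (ltW t0).
apply: cvg_trans ct; rewrite /quot_ge0; apply: cvg_fmap2.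
have th : \forall h \near (0 : R)^', 0 <= t + h.
  near=> h; have : `|h| < t by near: h; exact: dnbhs0_lt.
  by rewrite ltr_norml => /andP[+ _]; lra.
move=> Q hQ; have {}hQ : \forall h \near (0 : R)^', 0 <= t + h -> Q h := hQ.
by apply: filterS2 th hQ => h th; exact.
Unshelve. all: by end_near. Qed.

Lemma is_derive_cvg (f : R -> R) t l :
  h^-1 *: (f (t + h) - f t) @[h --> (0 : R)^'] --> l -> is_derive t 1 f l.
Proof.
move=> fl.
have hc : h^-1 *: ((f \o shift t) (h *: 1) - f t) @[h --> (0 : R)^'] --> l.
  apply: cvg_trans fl; apply: near_eq_cvg; near=> h => /=.
  by rewrite -[h%:A]/(h * 1) mulr1 (addrC h t).
by apply: DeriveDef; [rewrite /derivable; apply/cvg_ex; exists l; exact: hc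
  |rewrite /derive (cvg_lim _ hc)].
Unshelve. all: by end_near. Qed.

Lemma halfline_ndecr (f : R -> R) t : {within [set s | 0 <= s], continuous f} ->
  (forall x : R, 0 < x -> exists2 D, is_derive x 1 f D & 0 <= D) ->
  0 < t -> f 0 <= f t.
Proof.
move=> cf df t0.
(* f need not be differentiable at 0, hence an intermediate point in the open
   interval. *)
have [||c cst e] := @MVT R f (fun x => 'D_1 f x) 0 t t0.
- move=> x /[!in_itv]/= /andP[x0 _].
  by have [D [dfx _] _] := df x x0; exact: derivableP.
- apply: continuous_subspaceW cf => x /=.
  by rewrite in_itv/= => /andP[].
- rewrite in_itv/= in cst; case/andP: cst => c0 _.
  have [D [_ fD] D0] := df c c0.
  by rewrite -subr_ge0 e fD mulr_ge0// subr0 ltW.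
Qed.

End HalfLineCalculus.

Section HilbertSpace.
Context {R : realType} {H : completeNormedModType R}.
Variable dot : {dot H for @idfun R}.
Hypothesis hnorm : norm_from_dot dot.

Lemma dot_sym (x y : H) : dot x y = dot y x.
Proof. by rewrite hermC expr0 mul1r. Qed.

Lemma dotDl (x y z : H) : dot (x + y) z = dot x z + dot y z.
Proof. exact: linearDl. Qed.

Lemma dotZl (c : R) (x z : H) : dot (c *: x) z = c * dot x z.
Proof. exact: linearZl_LR. Qed.

Lemma dot0l (z : H) : dot 0 z = 0.
Proof. exact: linear0l. Qed.

(** Polarization makes the continuity of the scalar product a consequence of that
    of the norm. *)
Lemma dot_polar (x y : H) :
  dot x y = (`|x + y| ^+ 2 - `|x| ^+ 2 - `|y| ^+ 2) / 2.
Proof.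
rewrite !hnorm dotDl !(dot_sym _ (x + y)) !dotDl (dot_sym y x).
by field.
Qed.

Lemma cvg_dot {T} {F : set_system T} {FF : Filter F} (f : T -> H) (l v : H) :
  f @ F --> l -> dot (f x) v @[x --> F] --> dot l v.
Proof.
move=> fl; under eq_fun do rewrite dot_polar; rewrite dot_polar.
apply: cvgMl; apply: cvgB; last exact: cvg_cst.
apply: cvgB; last by rewrite expr2; apply: cvgM; exact: cvg_norm.
by rewrite expr2; apply: cvgM; apply: cvg_norm; apply: cvgD => //; exact: cvg_cst.
Qed.

Variable e : nat -> H.
Hypothesis orth : forall i j, dot (e i) (e j) = (i == j)%:R.

Lemma norm_sum_orth (c : nat -> R) m n :
  `|\sum_(m <= k < n) c k *: e k| ^+ 2 = \sum_(m <= k < n) c k ^+ 2.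
Proof.
elim: n => [|n IH]; first by rewrite !big_geq// normr0 expr0n.
have [mn|nm] := leqP m n; last by rewrite !big_geq// normr0 expr0n.
rewrite !big_nat_recr//= -IH.
have s0 : dot (\sum_(m <= k < n) c k *: e k) (c n *: e n) = 0.
  rewrite big_nat_cond; elim/big_ind: _ => [|x y x0 y0|k /andP[/andP[_ kn] _]].
  - exact: dot0l.
  - by rewrite dotDl x0 y0 addr0.
  - by rewrite dotZl dot_sym dotZl orth gtn_eqF// !mulr0.
rewrite !hnorm dotDl !(dot_sym _ (_ + _)) !dotDl s0 (dot_sym (c n *: e n)) s0.
by rewrite addr0 add0r dotZl dot_sym dotZl orth eqxx mulr1 expr2.
Qed.

(** Pythagoras turns the Cauchy criterion for the squares into the one for the
    vectors. *)
Lemma cvg_series_orth (c : nat -> R) :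
  cvgn (series (fun k => c k ^+ 2)) -> cvgn (series (fun k => c k *: e k)).
Proof.
move=> /cauchy_cvgP/cauchy_seriesP hc; apply/cauchy_cvgP/cauchy_seriesP => eps eps0.
have e2 : 0 < eps ^+ 2 by rewrite exprn_gt0.
move: (hc _ e2); apply: filterS => n /=; rewrite -norm_sum_orth.
rewrite ger0_norm ?sqr_ge0// => h.
by rewrite -(@ltr_pXn2r _ 2) ?nnegrE ?normr_ge0 ?(ltW eps0).
Qed.

Lemma norm_lim_series_orth (c : nat -> R) (x : H) :
  series (fun k => c k *: e k) @ \oo --> x ->
  series (fun k => c k ^+ 2) @ \oo --> `|x| ^+ 2.
Proof.
move=> cx; have h : `|series (fun k => c k *: e k) n| ^+ 2 @[n --> \oo] --> `|x| ^+ 2.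
  by rewrite expr2; apply: cvgM; exact: cvg_norm.
apply: cvg_trans h; apply: near_eq_cvg; near=> n.
by rewrite /series/= norm_sum_orth.
Unshelve. all: by end_near. Qed.

End HilbertSpace.

Unset Implicit Arguments.

Theorem theorem2p5 (R : realType) (H : completeNormedModType R)
  (dot : {dot H for @idfun R}) (hnorm : norm_from_dot dot)
  (D : set H) (A : H -> H) (hA : self_adjoint dot D A)
  (e : nat -> H) (he : orthonormal_basis dot e)
  (lam : nat -> R) (hlam_inc : increasing_seq lam)
  (hlam_pos : forall k, 0 < lam k)
  (heig : forall k, D (e k) /\ A (e k) = lam k ^+ 2 *: e k)
  (u0 u1 : H) (hu0 : dom_sqrt dot e lam u0)
  (u : R -> H) (hu : weak_solution dot D A e lam u0 u1 u)
  (hJ : infinite_set [set k | dot u1 (e k) ^+ 2 + dot u0 (e k) ^+ 2 <> 0])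
  (hgap : 0 < inf (range (fun k => lam k.+1 - lam k))) :
  t * (`|derive_ge0 u t| ^+ 2 + `|sqrt_op dot e lam (u t)| ^+ 2)
    @[t --> +oo] --> (2 : R).
Proof.
have [orth basis] := he.
have [[du cdu] udom [cu _] weak [uu0 uu1]] := hu.
pose x k t := dot (u t) (e k).
pose y k t := dot (derive_ge0 u t) (e k).
pose v t := `|derive_ge0 u t| ^+ 2.
pose a k t := y k t ^+ 2 + lam k ^+ 2 * x k t ^+ 2.
pose b k t := lam k ^+ 2 * x k t ^+ 2 - y k t ^+ 2.
pose d k t := 2 * lam k * x k t * y k t.
have parseval z : series (fun k => dot z (e k) ^+ 2) @ \oo --> `|z| ^+ 2.
  exact: (norm_lim_series_orth hnorm orth (basis z)).
have potential (t : R) : 0 <= t -> series (fun k => lam k ^+ 2 * x k t ^+ 2) @ \oo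
    --> `|sqrt_op dot e lam (u t)| ^+ 2.
  move=> t0; have := udom t t0; rewrite /dom_sqrt/= => hd.
  have sqE : (fun k => lam k ^+ 2 * x k t ^+ 2) = (fun k => (lam k * x k t) ^+ 2).
    by apply/funext => k; rewrite exprMn.
  rewrite sqE; apply: (norm_lim_series_orth hnorm orth).
  by apply: (cvg_series_orth hnorm orth); rewrite -sqE.
have energyE (t : R) : 0 <= t -> series (a ^~ t) @ \oo -->
    `|derive_ge0 u t| ^+ 2 + `|sqrt_op dot e lam (u t)| ^+ 2.
  move=> t0; have -> : series (a ^~ t) = series (fun k => y k t ^+ 2)
      + series (fun k => lam k ^+ 2 * x k t ^+ 2) by rewrite -seriesD.
  exact: cvgD (parseval _) (potential t t0).
have dx k (t : R) : 0 < t -> is_derive t 1 (x k) (y k t).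
  move=> t0; apply: is_derive_cvg.
  have hq := cvg_dot hnorm (v := e k) (cvg_quot_ge0 du t0).
  apply: (cvg_trans _ (hq _)); apply: near_eq_cvg; near=> h.
  by rewrite /x dotZl -scaleN1r dotDl dotZl mulN1r.
have dy k (t : R) : 0 < t -> is_derive t 1 (y k) (- (v t * y k t) - lam k ^+ 2 * x k t).
  move=> t0; have [De Ae] := heig k.
  have [dw /(_ t (ltW t0))] := weak _ De.
  rewrite Ae (dot_sym dot (u t)) dotZl (dot_sym dot (e k)) => /eqP.
  rewrite -addrA addr_eq0 opprD => /eqP hw.
  rewrite /v /y /x -hw; apply: is_derive_cvg; exact: (cvg_quot_ge0 dw t0).
have ab_y k (t : R) : a k t - b k t = 2 * y k t ^+ 2 by rewrite /a /b; ring.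
have da k (t : R) : 0 < t -> is_derive t 1 (a k) (- (v t * (a k t - b k t))).
  move=> t0; have hx := dx k t t0; have hy := dy k t t0.
  have -> : a k = fun s => y k s * y k s + lam k ^+ 2 * (x k s * x k s) by [].
  by eapply is_derive_eq; [pderiv|rewrite ab_y/=; ring].
have db k (t : R) : 0 < t ->
    is_derive t 1 (b k) (2 * lam k * d k t + v t * (a k t - b k t)).
  move=> t0; have hx := dx k t t0; have hy := dy k t t0.
  have -> : b k = fun s => lam k ^+ 2 * (x k s * x k s) + - (y k s * y k s) by [].
  by eapply is_derive_eq; [pderiv|rewrite ab_y /d/=; ring].
have dd k (t : R) : 0 < t ->
    is_derive t 1 (d k) (- (2 * lam k * b k t) - v t * d k t).
  move=> t0; have hx := dx k t t0; have hy := dy k t t0.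
  by eapply is_derive_eq; [rewrite /d; pderiv|rewrite /b /d/=; ring].
have a_ge0 k (t : R) : 0 <= a k t.
  rewrite /a; apply: addr_ge0; first exact: sqr_ge0.
  by apply: mulr_ge0; exact: sqr_ge0.
(* At time 0 only one-sided continuity is available; it transfers the initial
   data to positive times. *)
have cx k : {within [set s | 0 <= s], continuous (x k)}.
  by move=> t; exact: (cvg_dot hnorm (v := e k) (cu t)).
have cy k : {within [set s | 0 <= s], continuous (y k)}.
  by move=> t; exact: (cvg_dot hnorm (v := e k) (cdu t)).
have ca k : {within [set s | 0 <= s], continuous (a k)}.
  move=> t; rewrite /a; apply: cvgD; first by rewrite expr2; apply: cvgM; exact: cy.
  by apply: cvgMr; rewrite expr2; apply: cvgM; exact: cx.
have a_le k (t : R) : 0 < t -> a k t <= a k 0.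
  move=> t0; rewrite -lerN2.
  apply: (@halfline_ndecr _ (fun s => - a k s)) => //.
    by move=> s; apply: cvgN; exact: ca.
  move=> s s0; exists (v s * (a k s - b k s)).
    have das := da k s s0.
    by eapply is_derive_eq; [pderiv|rewrite opprK].
  rewrite ab_y; apply: mulr_ge0; first exact: sqr_ge0.
  by apply: mulr_ge0 => //; exact: sqr_ge0.
have al_cvg : cvgn (series (a ^~ 0)).
  by apply/cvg_ex; eexists; exact: (energyE 0 (lexx 0)).
have v_sum (t : R) : 2 * v t = tsum (fun k => a k t - b k t).
  have -> : (fun k => a k t - b k t) = (fun k => 2 * y k t ^+ 2).
    by apply/funext => k; exact: ab_y.
  have pv := parseval (derive_ge0 u t).
  rewrite tsumZ; last by apply/cvg_ex; eexists; exact: pv.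
  by congr (_ * _); rewrite /tsum (cvg_lim _ pv).
pose J := [set k | dot u1 (e k) ^+ 2 + dot u0 (e k) ^+ 2 <> 0].
have a0_gt0 k : J k -> 0 < a k 0.
  move=> Jk; rewrite lt_neqAle a_ge0 andbT; apply/eqP => a00; apply: Jk.
  have := sqr_ge0 (y k 0); have := sqr_ge0 (x k 0).
  move: a00; rewrite /a /y /x uu0 uu1 => a00 x2 y2.
  have lx2 := mulr_ge0 (sqr_ge0 (lam k)) x2.
  have l2 : 0 < lam k ^+ 2 by rewrite exprn_gt0.
  have -> : dot u1 (e k) ^+ 2 = 0 by lra.
  have /eqP : lam k ^+ 2 * dot u0 (e k) ^+ 2 = 0 by lra.
  by rewrite mulf_eq0 gt_eqF//= => /eqP ->; rewrite addr0.
pose V := tsum (a ^~ 0).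
have v_le (t : R) : 0 < t -> v t <= V.
  move=> t0; have pv := parseval (derive_ge0 u t).
  rewrite /v -(cvg_lim _ pv)//; apply: ler_tsum al_cvg _ => [|k].
    by apply/cvg_ex; eexists; exact: pv.
  apply: le_trans (a_le k t t0).
  by rewrite /a lerDl mulr_ge0 ?sqr_ge0.
(* The solution of a mode cannot come to rest in finite time: a_k' >= - 2 V a_k
   while V bounds the damping coefficient. *)
have a_gt0 k (t : R) : J k -> 0 < t -> 0 < a k t.
  move=> Jk t0; pose f s := a k s * expR (2 * V * s).
  have : f 0 <= f t.
    apply: (@halfline_ndecr _ f) => //.
      move=> s; apply: cvgM; first exact: ca.
      apply: continuous_subspaceT => r; apply: continuous_comp.
        by apply: cvgMr; exact: cvg_id.
      exact: continuous_expR.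
    move=> s s0; exists ((2 * V * a k s - v s * (a k s - b k s)) * expR (2 * V * s)).
      have das := da k s s0.
      have dis : is_derive s 1 (@id R) 1 by exact: is_derive_id.
      by eapply is_derive_eq; [rewrite /f; pderiv|rewrite /=; ring].
    rewrite mulr_ge0 ?expR_ge0// subr_ge0 ab_y.
    have ya : y k s ^+ 2 <= a k s by rewrite /a lerDl mulr_ge0 ?sqr_ge0.
    have v0 : 0 <= v s by exact: sqr_ge0.
    have := ler_pM v0 (sqr_ge0 (y k s)) (v_le s s0) ya; lra.
  rewrite /f mulr0 expR0 mulr1 => f0t.
  have := lt_le_trans (a0_gt0 k Jk) f0t.
  by rewrite pmulr_lgt0// expR_gt0.
have a_eq0 k (t : R) : ~ J k -> 0 < t -> a k t = 0.
  move=> nJ t0; apply/eqP; rewrite eq_le a_ge0 andbT.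
  apply: (le_trans (a_le k t t0)); move/contrapT : nJ => nJ.
  have := sqr_ge0 (y k 0); have := sqr_ge0 (x k 0).
  rewrite /a /y /x uu0 uu1 => x2 y2.
  have -> : dot u1 (e k) ^+ 2 = 0 by lra.
  have -> : dot u0 (e k) ^+ 2 = 0 by lra.
  by rewrite mulr0 addr0.
have lam_incr i k : (i <= k)%N -> lam i <= lam k by rewrite hlam_inc.
pose del := inf (range (fun k => lam k.+1 - lam k)).
have gap1 k : del <= lam k.+1 - lam k.
  apply: ge_inf; last by exists k.
  by exists 0 => _ [i _ <-]; rewrite subr_ge0 lam_incr.
have gap_lt i k : (i < k)%N -> del <= lam k - lam i.
  by move=> ik; have := gap1 i; have := lam_incr _ _ ik; lra.
have gap i k : i != k -> del <= `|lam k - lam i|.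
  rewrite neq_ltn => /orP[ik|ki].
    by rewrite (le_trans (gap_lt _ _ ik))// ler_norm.
  by rewrite distrC (le_trans (gap_lt _ _ ki))// ler_norm.
have bd_a k (t : R) : 0 < t -> b k t ^+ 2 + d k t ^+ 2 = a k t ^+ 2.
  by move=> _; rewrite /a /b /d; ring.
have := mode_system_asymp (hlam_pos 0%N) (fun k => lam_incr 0%N k (leq0n k)) hgap gap
  al_cvg da db dd bd_a (fun k t _ => a_ge0 k t) a_le (fun t _ => v_sum t) hJ a_gt0 a_eq0.
apply: cvg_trans; apply: near_eq_cvg; near=> t.
have t0 : 0 <= t by near: t; apply: nbhs_pinfty_ge; exact: num_real.
by rewrite /energy /tsum (cvg_lim _ (energyE t t0)).
Unshelve. all: by end_near. Qed.
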